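(* Let $\alpha\in(0,1)$, let $D\subset\mathbb{R}^d$ be an open set with $0\in D$, and let $f:D\to\mathbb{R}^d$ satisfy $f(0)=0$ and be Lipschitz continuous in a neighborhood of the origin. Consider the equation $$ {}^{C}D^{\alpha}_{0+}x(t)=f(x(t)),\quad t\in(0,\infty). $$ Assume there is a function $V:\mathbb{R}^d\to\mathbb{R}_{\ge0}$ satisfying: (V.1) $V$ is convex and differentiable on $\mathbb{R}^d$; (V.2) there exist constants $a,b,C_1,C_2,r>0$ (with $B_{\mathbb{R}^d}(0,r)\subset D$) such that $C_1\|x\|^a\le V(x)\le C_2\|x\|^b$ for all $x\in B_{\mathbb{R}^d}(0,r)$; (V.3) there are constants $C_3,c\ge0$ such that $\langle\nabla V(x),f(x)\rangle\le -C_3\|x\|^c$ for all $x\in B_{\mathbb{R}^d}(0,r)$. Then: (a) the trivial solution of the equation is stable if $C_3=0$; (b) the trivial solution of the equation is Mittag-Leffler stable if $C_3>0$.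
   Context: $\|\cdot\|$ and $\langle\cdot,\cdot\rangle$ are the Euclidean norm and scalar product on $\mathbb{R}^d$; $B_{\mathbb{R}^d}(0,r)$ is the closed ball of radius $r$ centered at $0$. For $\alpha\in(0,1)$ the Riemann--Liouville integral is $I^{\alpha}_{0+}x(t)=\frac{1}{\Gamma(\alpha)}\int_0^t(t-\tau)^{\alpha-1}x(\tau)\,d\tau$, the Riemann--Liouville derivative is ${}^{R}D^{\alpha}_{0+}x(t)=\frac{d}{dt}(I^{1-\alpha}_{0+}x)(t)$, and the Caputo derivative is ${}^{C}D^{\alpha}_{0+}x(t)={}^{R}D^{\alpha}_{0+}(x(t)-x(0))$, taken componentwise. Solutions are continuous functions. For $x_0$ near $0$, $\Phi(\cdot,x_0)$ denotes the solution with $\Phi(0,x_0)=x_0$ on its maximal interval of existence $[0,T_b(x_0))$ (solutions are unique as long as they stay in the neighborhood of the origin where $f$ is Lipschitz). Definitions. The trivial solution is stable if for any $\varepsilon>0$ there exists $\delta>0$ such that for all $\|x_0\|<\delta$ we have $T_b(x_0)=\infty$ and $\|\Phi(t,x_0)\|<\varepsilon$ for all $t\ge0$. The trivial solution is Mittag-Leffler stable if there exist positive constants $\beta,m,\delta$ such that for all $\|x_0\|\le\delta$ the solution $\Phi(\cdot,x_0)$ exists on $[0,\infty)$ and $\sup_{t\ge0}t^{\beta}\|\Phi(t,x_0)\|\le m$. *)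

(* Defs.v *)
From HB Require Import structures.
From mathcomp Require Import all_boot all_order all_algebra.
From mathcomp Require Import all_classical all_reals all_analysis.
Set Implicit Arguments.
Unset Strict Implicit.
Unset Printing Implicit Defensive.
Import Order.TTheory GRing.Theory Num.Theory.
Import numFieldNormedType.Exports.
Local Open Scope classical_set_scope.
Local Open Scope ring_scope.

(* The library norm `|x| on 'rV[R]_d is the sup norm: it provides the topology
   and differentiability on R^d (which do not depend on the choice of the
   norm), while quantitative estimates use the Euclidean structure below. *)
Definition dotv (R : realType) (d : nat) (u v : 'rV[R]_d) : R :=
  \sum_(i < d) u 0 i * v 0 i.

Definition enorm (R : realType) (d : nat) (u : 'rV[R]_d) : R :=
  Num.sqrt (dotv u u).

Definition eball (R : realType) (d : nat) (r : R) : set 'rV[R]_d :=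
  [set x | enorm x <= r].

Definition gradient (R : realType) (d : nat) (V : 'rV[R]_d -> R)
    (x : 'rV[R]_d) : 'rV[R]_d :=
  \row_(i < d) 'D_(delta_mx 0 i) V x.

Definition lipschitz_near0 (R : realType) (d : nat) (D : set 'rV[R]_d)
    (f : 'rV[R]_d -> 'rV[R]_d) : Prop :=
  exists U : set 'rV[R]_d, exists L : R,
    [/\ nbhs (0 : 'rV[R]_d) U, U `<=` D &
        forall x y, U x -> U y -> enorm (f x - f y) <= L * enorm (x - y)].

Definition Gamma (R : realType) (a : R) : R :=
  \int[lebesgue_measure]_(s in `]0, +oo[) (s `^ (a - 1) * expR (- s)).

Definition RL_integral (R : realType) (alpha : R) (g : R -> R) (t : R) : R :=
  (Gamma alpha)^-1 *
  \int[lebesgue_measure]_(s in `[0, t]) ((t - s) `^ (alpha - 1) * g s).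

Definition RL_derivable (R : realType) (alpha : R) (g : R -> R) (t : R) : Prop :=
  derivable (RL_integral (1 - alpha) g) t 1.

Definition RL_derive (R : realType) (alpha : R) (g : R -> R) (t : R) : R :=
  derive1 (RL_integral (1 - alpha) g) t.

Definition caputo_derivable (R : realType) (d : nat) (alpha : R)
    (x : R -> 'rV[R]_d) (t : R) : Prop :=
  forall i, RL_derivable alpha (fun s => x s 0 i - x 0 0 i) t.

Definition caputo_derive (R : realType) (d : nat) (alpha : R)
    (x : R -> 'rV[R]_d) (t : R) : 'rV[R]_d :=
  \row_(i < d) RL_derive alpha (fun s => x s 0 i - x 0 0 i) t.

(* The interval [0, T), where T may be +oo. *)
Definition time_dom (R : realType) (T : \bar R) : set R :=
  [set t | 0 <= t /\ (t%:E < T)%E].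

(* f is a function on D represented by a total function; since solutions take
   values in D, its values outside D are irrelevant. Likewise only the values
   of x on [0, T) matter. *)
Definition caputo_solution (R : realType) (d : nat) (alpha : R)
    (D : set 'rV[R]_d) (f : 'rV[R]_d -> 'rV[R]_d) (x0 : 'rV[R]_d)
    (T : \bar R) (x : R -> 'rV[R]_d) : Prop :=
  [/\ (0 < T)%E,
      x 0 = x0,
      {within time_dom T, continuous x},
      (forall t, time_dom T t -> D (x t)) &
      forall t, time_dom T t -> 0 < t ->
        caputo_derivable alpha x t /\ caputo_derive alpha x t = f (x t)].

Definition maximal_solution (R : realType) (d : nat) (alpha : R)
    (D : set 'rV[R]_d) (f : 'rV[R]_d -> 'rV[R]_d) (x0 : 'rV[R]_d)
    (T : \bar R) (x : R -> 'rV[R]_d) : Prop :=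
  caputo_solution alpha D f x0 T x /\
  forall (T' : \bar R) (y : R -> 'rV[R]_d), (T < T')%E ->
    (forall t, time_dom T t -> y t = x t) ->
    ~ caputo_solution alpha D f x0 T' y.

(* "The solution Phi(., x0) on [0, T_b(x0)) satisfies P". As f is only assumed
   Lipschitz near the origin, the solution could fail to be unique once it
   leaves that neighborhood; hence P is required of every maximal solution
   issued from x0, together with the existence of one. *)
Definition maximal_solution_satisfies (R : realType) (d : nat) (alpha : R)
    (D : set 'rV[R]_d) (f : 'rV[R]_d -> 'rV[R]_d) (x0 : 'rV[R]_d)
    (P : \bar R -> (R -> 'rV[R]_d) -> Prop) : Prop :=
  (exists T x, maximal_solution alpha D f x0 T x) /\
  (forall T x, maximal_solution alpha D f x0 T x -> P T x).

Definition stable (R : realType) (d : nat) (alpha : R)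
    (D : set 'rV[R]_d) (f : 'rV[R]_d -> 'rV[R]_d) : Prop :=
  forall eps : R, 0 < eps -> exists2 delta : R, 0 < delta &
    forall x0 : 'rV[R]_d, enorm x0 < delta ->
      maximal_solution_satisfies alpha D f x0 (fun T x =>
        T = +oo%E /\ forall t, 0 <= t -> enorm (x t) < eps).

Definition mittag_leffler_stable (R : realType) (d : nat) (alpha : R)
    (D : set 'rV[R]_d) (f : 'rV[R]_d -> 'rV[R]_d) : Prop :=
  exists beta m delta : R, [/\ 0 < beta, 0 < m, 0 < delta &
    forall x0 : 'rV[R]_d, enorm x0 <= delta ->
      maximal_solution_satisfies alpha D f x0 (fun T x =>
        T = +oo%E /\
        let S := [set (t `^ beta * enorm (x t))%:E | t in `[0, +oo[] in
        (ereal_sup S <= m%:E)%E)].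

(* Main.v *)
Require Import Defs.
From HB Require Import structures.
From mathcomp Require Import all_boot all_order all_algebra.
From mathcomp Require Import all_classical all_reals all_analysis.
From mathcomp Require Import measurable_realfun ring lra.
Set Implicit Arguments.
Unset Strict Implicit.
Unset Printing Implicit Defensive.
Import Order.TTheory GRing.Theory Num.Theory.
Import numFieldNormedType.Exports.
Local Open Scope classical_set_scope.
Local Open Scope ring_scope.

(** Why the theorem holds.

Write [A_b g t] for the integral of [(t - s) ^ (b - 1) * g s] over [s] in
[0, t], which is [Gamma b] times the Riemann-Liouville integral of order [b].
By Tonelli on the triangle and an affine change of variable,
[A_(1-b) (A_b g) t = B * int_0^t g] with [B = B(b, 1 - b)], so as long as [x]
stays where [f] is Lipschitz the Caputo equation is the Volterra equation
[x = x0 + kappa * A_alpha (f x)], [kappa = Gamma (1 - alpha) / B]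
(RL_derive_volterra, volterra_of_RL_derive).

The Lyapunov argument replaces the chain rule, which fails for fractional
derivatives, by a maximum principle (kernel_integral_max_principle): if
[w = A_alpha g] attains its maximum over [0, t] at [t > 0], then
[w t * t ^ (- alpha) <= B * g t].  Indeed the increment of [A_(1-alpha) w] is
[B] times the integral of [g] over [t - h, t], whereas the kernel decreases, so
that the past, where [w <= w t], pulls this increment up.  The recent past needs
[w t - w (t - h) = o (h ^ alpha)]; this borderline regularity comes from the
continuity of [g] (kernel_integral_little_holder).

Let [x] solve the Volterra equation and let [p] be the gradient of [V] at [x t].
As [V] is convex, [<p, x s - x t> <= V (x s) - V (x t)] (tangent_le).  So if
[V (x s)] for [s <= t] exceeds [V (x t)] by at most
[lam * (t ^ alpha - s ^ alpha)], the scalar function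
[<p, x s - x0> + lam * s ^ alpha], which is again some [kappa * A_alpha g], is
maximal at [t], and the maximum principle bounds [<p, f (x t)>] from below
(lyapunov_barrier).

Stability: take [lam = 0] at a time where [V (x t)] is maximal.  If that time is
positive and the maximum exceeds [V x0], then [<p, f (x t)> > 0], contradicting
the decay hypothesis.  Hence [V (x t) <= V x0] while [x] is in the ball
(V_le_initial), and the bounds on [V] keep [x] from reaching the sphere
(V_stays_in_ball).

Decay: let [t] be a maximum point of [t ^ beta * V (x t)] over [0, T], with
[beta = min (alpha * b / c, alpha)].  Then [V (x s) <= (t / s) ^ beta * V (x t)]
for [s <= t], and [V (x s)] is bounded near [s = 0] by the stability part; so the
hypothesis of lyapunov_barrier holds with [lam = O (t ^ (- alpha))], and
the decay hypothesis gives [C3 * |x t| ^ c = O (t ^ (- alpha))].  Hence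
[t ^ beta * V (x t)] is bounded independently of [T] (V_algebraic_decay), and the
lower bound on [V] turns this into a bound on [t ^ (beta / a) * |x t|].

Existence: [f] composed with the projection onto a small cube is globally
Lipschitz, and Picard iteration gives a global Volterra solution.  By the
estimates above it stays where the projection is the identity, so it solves
the original equation.  A maximal solution from the same point agrees with it
up to its first exit from the ball, hence never exits, and by maximality it is
defined for all times (maximal_solutions_eq). *)

(** * The power kernel *)

Section power_kernel.
Context {R : realType}.
Notation mu := (@lebesgue_measure R).
Implicit Types (a b c t s h x y : R).

Lemma is_derive_subl t x : is_derive x 1 (fun s => t - s) (-1).
Proof.
have : is_derive x 1 (cst t - id : R -> R) (0 - 1) by exact: is_deriveB.
by rewrite sub0r.
Qed.

Lemma is_derive_kernel_primitive b t x : x < t ->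
  is_derive x 1 (fun s => - (t - s) `^ b / b) (b * (t - x) `^ (b - 1) / b).
Proof.
move=> xt; have tx : 0 < t - x by rewrite subr_gt0.
have H := is_derive1_powR b tx.
have H2 : is_derive x 1 (fun s => t - s) (-1).
  exact: is_derive_subl.
have H3 := @is_derive1_comp _ (fun y => y `^ b) (fun s => t - s) x _ _ H H2.
have H4 : is_derive x 1 (fun s => - b^-1 * ((powR (R:=R))^~ b \o (fun s => t - s)) s)
   (- b^-1 * (b * (t - x) `^ (b - 1) * -1)) by exact: is_deriveZ.
have -> : (fun s => - (t - s) `^ b / b) =
  (fun s => - b^-1 * ((powR (R:=R))^~ b \o (fun s => t - s)) s).
  by apply/funext => s /=; ring.
by have -> : b * (t - x) `^ (b - 1) / b = - b^-1 * (b * (t - x) `^ (b - 1) * -1) by ring.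
Qed.

Lemma integral_kernel_lt b t a c : 0 < b -> a < c -> c < t ->
  (\int[mu]_(s in `[a, c]) ((t - s) `^ (b - 1))%:E =
   ((t - a) `^ b / b - (t - c) `^ b / b)%:E)%E.
Proof.
move=> b0 ac ct.
have dF x : x < t -> is_derive x 1 (fun s => - (t - s) `^ b / b) ((t - x) `^ (b - 1)).
  move=> xt; have := is_derive_kernel_primitive b xt.
  by rewrite mulrAC divff ?gt_eqF// mul1r.
have cF x : x < t -> {for x, continuous (fun s => - (t - s) `^ b / b)}.
  move=> xt; apply: differentiable_continuous.
  by apply/derivable1_diffP; apply: ex_derive; apply: dF.
rewrite (@continuous_FTC2 _ _ (fun s => - (t - s) `^ b / b) a c)//.
- by rewrite !mulNr -EFinB opprK addrC.
- apply: derivable_within_continuous => x; rewrite in_itv/= => /andP[_ xc].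
  have xt : 0 < t - x by rewrite subr_gt0 (le_lt_trans xc).
  have H := is_derive1_powR (b - 1) xt.
  have H2 : is_derive x 1 (fun s => t - s) (-1).
    exact: is_derive_subl.
  by apply: ex_derive; exact: (@is_derive1_comp _ (fun y => y `^ (b - 1)) (fun s => t - s) x _ _ H H2).
- split.
  + by move=> x; rewrite in_itv/= => /andP[_ xc]; apply: ex_derive; apply: dF; apply: lt_trans ct.
  + by apply: cvg_at_right_filter; apply: cF; apply: lt_trans ct.
  + by apply: cvg_at_left_filter; exact: cF.
- move=> x; rewrite in_itv/= => /andP[_ xc].
  by rewrite derive1E; apply: derive_val; apply: dF; apply: lt_trans ct.
Qed.

Lemma measurable_kernel b t (A : set R) :
  measurable_fun A (fun s => (t - s) `^ (b - 1)).
Proof.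
apply: measurable_funTS.
apply: (@measurableT_comp _ _ _ _ _ _ (fun x : R => x `^ (b - 1))).
  exact: measurable_powR.
by apply: measurable_funB.
Qed.

(** The kernel is unbounded at [t] when [b < 1]: the fundamental theorem of
    calculus applies on [a, t - 1 / (k + 1)], and monotone convergence does the
    rest. *)
Lemma integral_kernel b t a : 0 < b -> a <= t ->
  (\int[mu]_(s in `[a, t]) ((t - s) `^ (b - 1))%:E = ((t - a) `^ b / b)%:E)%E.
Proof.
move=> b0; rewrite le_eqVlt => /predU1P[->|at_].
  by rewrite set_itv1 integral_set1 subrr powR0 ?gt_eqF// mul0r.
rewrite -integral_itv_bndo_bndc; last first.
  by apply/measurable_EFinP; exact: measurable_kernel.
rewrite itv_bnd_open_bigcup.
set F := fun k : nat => _.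
have Fnd : nondecreasing_seq F.
  move=> m n mn; rewrite subsetEset; apply: subset_itvl; rewrite bnd_simp.
  by rewrite lerB// lef_pV2 ?posrE// ler_nat ltnS.
have := @ge0_nondecreasing_set_cvg_integral _ (measurableTypeR R) R F
  (fun s => ((t - s) `^ (b - 1))%:E) lebesgue_measure.
move=> /(_ Fnd) H.
have {}H : (\int[mu]_(s in F k) ((t - s) `^ (b - 1))%:E)%E @[k --> \oo] -->
    (\int[mu]_(s in \bigcup_k F k) ((t - s) `^ (b - 1))%:E)%E.
  apply: H.
  - by move=> i; exact: measurable_itv.
  - by move=> i; apply/measurable_EFinP; exact: measurable_kernel.
  - by move=> i x _; rewrite lee_fin powR_ge0.
apply: (cvg_unique _ H) => //.
apply: (@cvg_trans _ ((((t - a) `^ b / b - ((k.+1)%:R^-1) `^ b / b)%:E @[k --> \oo]))).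
  apply: near_eq_cvg; near=> k.
  rewrite /F integral_kernel_lt//.
  - by rewrite subKr.
  - rewrite ltrBrDl -ltrBrDr; near: k.
    have ta : 0 < t - a by rewrite subr_gt0.
    exact: near_infty_natSinv_lt (PosNum ta).
  - by rewrite ltrBlDr ltrDl invr_gt0.
apply: cvg_EFin; first exact: nearW.
rewrite -[X in _ --> X]subr0; apply: cvgB; first exact: cvg_cst.
rewrite -[X in _ --> X](mul0r b^-1); apply: cvgMl.
apply: (@cvg_comp _ _ _ (fun k : nat => k.+1%:R^-1 : R) (fun x => x `^ b) _ (0^'+)); last exact: powR_cvg0.
move=> A [e /= e0 eA]; near=> k; apply: eA => /=.
  rewrite sub0r normrN gtr0_norm ?invr_gt0//; near: k.
  exact: near_infty_natSinv_lt (PosNum e0).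
by rewrite invr_gt0.
Unshelve. all: by end_near. Qed.

Lemma integrable_kernel b t a : 0 < b ->
  mu.-integrable `[a, t] (EFin \o (fun s => (t - s) `^ (b - 1))).
Proof.
move=> b0; have [at_|ta] := leP a t; last first.
  by rewrite set_itv_ge ?bnd_simp -?ltNge//; exact: integrable_set0.
apply/integrableP; split; first by apply/measurable_EFinP; exact: measurable_kernel.
under eq_integral do rewrite /= ger0_norm ?powR_ge0//.
by rewrite integral_kernel// ltry.
Qed.

End power_kernel.

(** * Fractional integrals of continuous functions *)

Section unnormalized_RL_integral.
Context {R : realType}.
Notation mu := (@lebesgue_measure R).
Implicit Types (a b c t s h x y u l M T : R) (f g : R -> R).

(** [Gamma b] times the Riemann-Liouville integral of order [b].  It depends on
    [g] only through its values on [0, t] and vanishes for [t <= 0], so that it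
    is a continuous function on the whole line. *)
Definition kernel_integral b g t : R :=
  \int[mu]_(s in `[0, t]) ((t - s) `^ (b - 1) * g s).

(** The integral of the kernel over an interval of length [x] ending at its
    singularity. *)
Definition kernel_mass b x : R := x `^ b / b.

Lemma kernel_mass0 b : 0 < b -> kernel_mass b 0 = 0.
Proof. by move=> b0; rewrite /kernel_mass powR0 ?gt_eqF// mul0r. Qed.

Lemma kernel_mass_ge0 b x : 0 < b -> 0 <= kernel_mass b x.
Proof. by move=> b0; rewrite /kernel_mass divr_ge0 ?powR_ge0// ltW. Qed.

Lemma kernel_mass_le b x y : 0 < b -> 0 <= x -> x <= y ->
  kernel_mass b x <= kernel_mass b y.
Proof.
move=> b0 x0 xy; rewrite /kernel_mass ler_pM2r ?invr_gt0//.
by rewrite ge0_ler_powR// ?nnegrE ?(ltW b0)// (le_trans x0).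
Qed.

Lemma continuous_bounded g T : continuous g ->
  exists M, 0 <= M /\ forall s, 0 <= s <= T -> `|g s| <= M.
Proof.
move=> cg; have [T0|T0] := leP 0 T; last first.
  exists 0; split=> // s /andP[s0 sT].
  by have := lt_le_trans T0 s0; rewrite ltNge sT.
have cng : {within `[0, T], continuous (fun s => `|g s|)}.
  apply: continuous_subspaceT => x.
  by apply: continuous_comp; [exact: cg|exact: norm_continuous].
have [c _ cM] := EVT_max T0 cng.
by exists `|g c|; split=> // s sT; apply: cM; rewrite in_itv.
Qed.

Lemma integrable_kernelM b t a c g : 0 < b -> continuous g -> c <= t ->
  mu.-integrable `[a, c] (EFin \o (fun s => (t - s) `^ (b - 1) * g s)).
Proof.
move=> b0 cg ct.
have H : mu.-integrable `[a, t]
    (fun s => ((t - s) `^ (b - 1))%:E * (g s)%:E)%E.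
  apply: (@integrableMl _ (measurableTypeR R)) => //.
  - exact: integrable_kernel.
  - by apply: measurable_funTS; exact: continuous_measurable_fun.
  - have /compact_bounded[M [_ mrt]] : compact (g @` `[a, t]).
      apply: continuous_compact; last exact: segment_compact.
      exact: continuous_subspaceT.
    by exists M; split; rewrite ?num_real // => ? ? ? ?; exact: mrt.
apply: (@integrableS _ (measurableTypeR R) R mu `[a, t]) => //.
by apply: subset_itvl; rewrite bnd_simp.
Qed.

Lemma Rintegral_itv_split f a x c : mu.-integrable `[a, c] (EFin \o f) ->
  a <= x -> x <= c ->
  \int[mu]_(s in `[a, c]) f s =
  \int[mu]_(s in `[a, x]) f s + \int[mu]_(s in `[x, c]) f s.
Proof.
move=> itf ax xc.
have := @Rintegral_itvB _ f (BLeft a) (BRight c) x itf.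
rewrite !bnd_simp => /(_ ax xc) H.
rewrite -(@Rintegral_itv_obnd_cbnd _ x (BRight c)).
  by rewrite -H addrC subrK.
apply: integrableS itf => //; apply: subset_itvr.
by rewrite bnd_simp.
Qed.

Lemma Rintegral_kernel b t a c : 0 < b -> a <= c -> c <= t ->
  \int[mu]_(s in `[a, c]) ((t - s) `^ (b - 1)) =
  kernel_mass b (t - a) - kernel_mass b (t - c).
Proof.
move=> b0 ac ct.
have H x : x <= t -> \int[mu]_(s in `[x, t]) ((t - s) `^ (b - 1)) =
    kernel_mass b (t - x).
  by move=> xt; rewrite /Rintegral integral_kernel.
have := @Rintegral_itv_split _ _ _ _ (integrable_kernel t a b0) ac ct.
rewrite !H// ?(le_trans ac)// => ->.
by rewrite addrK.
Qed.

(** The right end is excluded because [0 `^ (b - 1) = 0] for [b < 1]: at its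
    singularity the kernel takes a value smaller than those nearby. *)
Lemma le_Rintegral_itv_bndo f g a c :
  mu.-integrable `[a, c] (EFin \o f) -> mu.-integrable `[a, c] (EFin \o g) ->
  (forall x, a <= x < c -> f x <= g x) ->
  \int[mu]_(s in `[a, c]) f s <= \int[mu]_(s in `[a, c]) g s.
Proof.
move=> itf itg fg.
have S : `[a, c[ `<=` `[a, c] by apply: subset_itvl; rewrite bnd_simp.
have itf' := @integrableS _ (measurableTypeR R) R mu _ _ _ (measurable_itv `[a, c]) (measurable_itv `[a, c[) S itf.
have itg' := @integrableS _ (measurableTypeR R) R mu _ _ _ (measurable_itv `[a, c]) (measurable_itv `[a, c[) S itg.
rewrite -!Rintegral_itv_bndo_bndc//.
by apply: le_Rintegral => // x /=; rewrite in_itv/= => /fg.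
Qed.

Lemma Rintegral_kernelM_le b t a c g u : 0 < b -> continuous g ->
  a <= c -> c <= t -> (forall s, a <= s <= c -> g s <= u) ->
  \int[mu]_(s in `[a, c]) ((t - s) `^ (b - 1) * g s) <=
  u * (kernel_mass b (t - a) - kernel_mass b (t - c)).
Proof.
move=> b0 cg ac ct gu.
rewrite -Rintegral_kernel// -RintegralZl//; last first.
  apply: integrableS (integrable_kernel t a b0) => //.
  by apply: subset_itvl; rewrite bnd_simp.
apply: le_Rintegral => //.
- exact: integrable_kernelM.
- have cu : continuous (cst u : R -> R) by move=> x; exact: cst_continuous.
  have := integrable_kernelM a b0 cu ct.
  by apply: eq_integrable => // x _ /=; rewrite mulrC.
- move=> x /=; rewrite in_itv/= => xac; rewrite [leRHS]mulrC.
  by rewrite ler_wpM2l ?powR_ge0// gu.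
Qed.

(** For fixed [s] the kernel decreases with the later time, so the integrand on
    the right is [g] times a nonnegative weight whose mass is explicit. *)
Lemma Rintegral_kernel_diff_ge b t0 t a c g l : 0 < b -> b <= 1 ->
  continuous g -> a <= c -> c <= t0 -> t0 <= t ->
  (forall s, a <= s <= c -> l <= g s) ->
  l * (kernel_mass b (t0 - a) - kernel_mass b (t0 - c)
       - (kernel_mass b (t - a) - kernel_mass b (t - c))) <=
  \int[mu]_(s in `[a, c]) ((t0 - s) `^ (b - 1) * g s) -
  \int[mu]_(s in `[a, c]) ((t - s) `^ (b - 1) * g s).
Proof.
move=> b0 b1 cg ac ct0 t0t lg.
have ct := le_trans ct0 t0t.
have i0 f : continuous f -> mu.-integrable `[a, c] (EFin \o (fun s => (t0 - s) `^ (b - 1) * f s)).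
  by move=> cf; exact: integrable_kernelM.
have i1 f : continuous f -> mu.-integrable `[a, c] (EFin \o (fun s => (t - s) `^ (b - 1) * f s)).
  by move=> cf; exact: integrable_kernelM.
have cl : continuous (cst l : R -> R) by move=> x; exact: cst_continuous.
have E t' : c <= t' -> \int[mu]_(s in `[a, c]) ((t' - s) `^ (b - 1) * (cst l s)) =
    l * (kernel_mass b (t' - a) - kernel_mass b (t' - c)).
  move=> ct'; rewrite -Rintegral_kernel// -RintegralZl//.
    by apply: eq_Rintegral => x _; rewrite mulrC.
  apply: integrableS (integrable_kernel t' a b0) => //.
  by apply: subset_itvl; rewrite bnd_simp.
rewrite mulrBr -!E//.
rewrite -!RintegralB//; [|exact: i0|exact: i1|exact: i0|exact: i1].
have iB f : continuous f -> mu.-integrable `[a, c]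
   (EFin \o (fun s => (t0 - s) `^ (b - 1) * f s - (t - s) `^ (b - 1) * f s)).
  move=> cf; have := @integrableB _ (measurableTypeR R) R mu _ (measurable_itv `[a, c]) _ _ (i0 _ cf) (i1 _ cf).
  exact: eq_integrable.
apply: le_Rintegral_itv_bndo; [exact: iB|exact: iB|].
move=> x /andP[ax xc]; rewrite -!mulrBl ler_wpM2l//; last by rewrite lg// ax ltW.
have t0x : 0 < t0 - x by rewrite subr_gt0 (lt_le_trans xc).
have tx : 0 < t - x by rewrite (lt_le_trans t0x)// lerB.
rewrite subr_ge0 -(opprB 1 b) !powRN lef_pV2 ?posrE ?powR_gt0//.
by rewrite ge0_ler_powR// ?nnegrE ?(ltW t0x) ?(ltW tx) ?lerD2r ?subr_ge0.
Qed.

Lemma kernel_integral_le0 b g t : t <= 0 -> kernel_integral b g t = 0.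
Proof.
rewrite /kernel_integral le_eqVlt => /predU1P[->|t0].
  by rewrite set_itv1 Rintegral_set1.
by rewrite set_itv_ge ?bnd_simp -?ltNge// Rintegral_set0.
Qed.

(** From [t0] to [t] the recent values on [t0, t] are added with a positive
    weight, and the past is reweighted by a negative difference of kernels.  Hence
    an upper bound on the former and lower bounds on the latter suffice.  The past
    is cut at [a] so as to allow a sharp bound near [t0] and a crude one before.
    Hoelder continuity, its borderline refinement and the maximum principle are
    all instances. *)
Lemma kernel_integral_increment_le b g a t0 t u l l' :
  0 < b -> b <= 1 -> continuous g -> 0 <= a -> a <= t0 -> t0 <= t ->
  (forall s, t0 <= s <= t -> g s <= u) ->
  (forall s, a <= s <= t0 -> l <= g s) ->
  (forall s, 0 <= s <= a -> l' <= g s) ->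
  kernel_integral b g t - kernel_integral b g t0 <=
  u * kernel_mass b (t - t0)
  - l * (kernel_mass b (t0 - a) - kernel_mass b (t - a) + kernel_mass b (t - t0))
  - l' * (kernel_mass b t0 - kernel_mass b (t0 - a)
          - (kernel_mass b t - kernel_mass b (t - a))).
Proof.
move=> b0 b1 cg a0 at0 t0t gu gl gl'.
have at_ := le_trans at0 t0t.
rewrite /kernel_integral.
rewrite (@Rintegral_itv_split _ 0 t0 t) ?(le_trans a0)//; last first.
  exact: integrable_kernelM.
rewrite [X in X + _ - _](@Rintegral_itv_split _ 0 a t0)//; last first.
  exact: integrable_kernelM.
rewrite [X in _ - X](@Rintegral_itv_split _ 0 a t0)//; last first.
  exact: integrable_kernelM.
have H1 := @Rintegral_kernelM_le b t t0 t g u b0 cg t0t (lexx _) gu.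
have H2 := @Rintegral_kernel_diff_ge b t0 t a t0 g l b0 b1 cg at0 (lexx _) t0t gl.
have H3 := @Rintegral_kernel_diff_ge b t0 t 0 a g l' b0 b1 cg a0 at0 t0t gl'.
move: H1 H2 H3; rewrite (subrr t) (subrr t0) (subr0 t) (subr0 t0) (kernel_mass0 b0).
set I1 := \int[mu]_(s in `[t0, t]) _.
set I2 := \int[mu]_(s in `[a, t0]) ((t0 - s) `^ (b - 1) * g s).
set I3 := \int[mu]_(s in `[a, t0]) ((t - s) `^ (b - 1) * g s).
set I4 := \int[mu]_(s in `[0, a]) ((t0 - s) `^ (b - 1) * g s).
set I5 := \int[mu]_(s in `[0, a]) ((t - s) `^ (b - 1) * g s).
move: I1 I2 I3 I4 I5 => I1 I2 I3 I4 I5; lra.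
Qed.

Lemma kernel_integralN b g t : 0 < b -> continuous g ->
  kernel_integral b (fun s => - g s) t = - kernel_integral b g t.
Proof.
move=> b0 cg; rewrite /kernel_integral -[RHS]mulN1r -RintegralZl//; last first.
  exact: integrable_kernelM.
by apply: eq_Rintegral => x _; rewrite mulrN mulN1r.
Qed.

Lemma kernel_integralZ b k g t : 0 < b -> continuous g ->
  kernel_integral b (fun s => k * g s) t = k * kernel_integral b g t.
Proof.
move=> b0 cg; rewrite /kernel_integral -RintegralZl//; last first.
  exact: integrable_kernelM.
by apply: eq_Rintegral => x _; rewrite mulrCA.
Qed.

Lemma kernel_integralD b f g t : 0 < b -> continuous f -> continuous g ->
  kernel_integral b (fun s => f s + g s) t =
  kernel_integral b f t + kernel_integral b g t.
Proof.
move=> b0 cf cg; rewrite /kernel_integral -RintegralD//; try exact: integrable_kernelM.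
by apply: eq_Rintegral => x _; rewrite mulrDr.
Qed.

Lemma le_kernel_integral b f g t : 0 < b -> continuous f -> continuous g ->
  (forall s, 0 <= s <= t -> f s <= g s) ->
  kernel_integral b f t <= kernel_integral b g t.
Proof.
move=> b0 cf cg fg; apply: le_Rintegral => //; try exact: integrable_kernelM.
by move=> x /=; rewrite in_itv/= => /fg fgx; rewrite ler_wpM2l ?powR_ge0.
Qed.

Lemma eq_kernel_integral b f g t :
  (forall s, 0 <= s <= t -> f s = g s) ->
  kernel_integral b f t = kernel_integral b g t.
Proof.
move=> fg; apply: eq_Rintegral => x; rewrite inE/= in_itv/= => /fg ->//.
Qed.

Lemma kernel_integral_cst b k t : 0 < b -> 0 <= t ->
  kernel_integral b (cst k) t = k * kernel_mass b t.
Proof.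
move=> b0 t0; rewrite -[in RHS](subr0 t) -[X in _ * X]subr0.
rewrite -[X in _ - X](kernel_mass0 b0) -[X in _ - _ _ X](subrr t).
rewrite -Rintegral_kernel// -RintegralZl//; last exact: integrable_kernel.
by apply: eq_Rintegral => x _; rewrite mulrC.
Qed.

Lemma kernel_integral_holder b g M t0 t : 0 < b -> b <= 1 -> continuous g ->
  0 <= t0 -> t0 <= t -> (forall s, 0 <= s <= t -> `|g s| <= M) ->
  `|kernel_integral b g t - kernel_integral b g t0| <= M *+ 2 * kernel_mass b (t - t0).
Proof.
move=> b0 b1 cg t00 t0t gM.
have M0 : 0 <= M by apply: le_trans (gM 0 _); rewrite ?normr_ge0// lexx (le_trans t00).
suff H f : continuous f -> (forall s, 0 <= s <= t -> `|f s| <= M) ->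
    kernel_integral b f t - kernel_integral b f t0 <= M *+ 2 * kernel_mass b (t - t0).
  rewrite ler_norml H// andbT.
  have := H (fun s => - g s); rewrite !kernel_integralN//.
  have cNg : continuous (fun s => - g s).
    by move=> x; apply: continuousN; exact: cg.
  rewrite opprK addrC => /(_ cNg) H'; rewrite lerNl opprB.
  by apply: H' => s /gM; rewrite normrN.
move=> cf fM.
have fM' s : 0 <= s <= t -> - M <= f s <= M by move/fM; rewrite ler_norml.
have := @kernel_integral_increment_le b f 0 t0 t M (- M) (- M) b0 b1 cf (lexx _) t00 t0t.
move/(_ _ _ _)/le_trans; apply.
- move=> s /andP[s0 st]; have Hs : 0 <= s <= t by rewrite st (le_trans t00).
  by case/andP: (fM' _ Hs).
- move=> s /andP[s0 st]; have Hs : 0 <= s <= t by rewrite s0 (le_trans st).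
  by case/andP: (fM' _ Hs).
- move=> s /andP[s0 st]; have Hs : 0 <= s <= t.
    by rewrite s0 (le_trans st)// (le_trans t00).
  by case/andP: (fM' _ Hs).
have := kernel_mass_le b0 t00 t0t.
rewrite !subr0 -mulr_natl => PP.
suff : M * kernel_mass b t0 <= M * kernel_mass b t by lra.
exact: ler_wpM2l.
Qed.

Lemma continuous_kernel_integral b g : 0 < b -> b <= 1 -> continuous g ->
  continuous (kernel_integral b g).
Proof.
move=> b0 b1 cg x.
have [M [M0 gM]] := @continuous_bounded g (`|x| + 1) cg.
have H t0 t : t0 <= t -> t <= `|x| + 1 ->
    `|kernel_integral b g t - kernel_integral b g t0| <= M *+ 2 * kernel_mass b (t - t0).
  move=> t0t tx.
  have gMt s : 0 <= s <= t -> `|g s| <= M.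
    by move=> /andP[s0 st]; apply: gM; rewrite s0 (le_trans st).
  have [t00|t00] := leP 0 t0; first exact: kernel_integral_holder.
  rewrite [X in _ - X](kernel_integral_le0 _ _ (ltW t00)).
  have [tl0|tg0] := leP t 0.
    rewrite (kernel_integral_le0 _ _ tl0) subrr normr0.
    by rewrite mulr_ge0 ?mulrn_wge0// kernel_mass_ge0.
  rewrite -(kernel_integral_le0 b g (lexx 0)).
  apply: le_trans (kernel_integral_holder b0 b1 cg (lexx 0) (ltW tg0) gMt) _.
  rewrite ler_wpM2l ?mulrn_wge0// kernel_mass_le// ?subr_ge0 ?(ltW tg0)//.
  by rewrite subr0 lerDl oppr_ge0 ltW.
apply/cvgrPdist_le => /= e e0.
pose d := (e * b / (M *+ 2 + 1)) `^ b^-1.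
have M1 : 0 < M *+ 2 + 1 by rewrite ltr_wpDl ?mulrn_wge0.
have d0 : 0 < d by rewrite powR_gt0// divr_gt0// mulr_gt0.
have dP y : 0 <= y -> y <= d -> M *+ 2 * kernel_mass b y <= e.
  move=> y0 yd; apply: (@le_trans _ _ ((M *+ 2 + 1) * kernel_mass b d)).
    apply: ler_pM; rewrite ?mulrn_wge0 ?kernel_mass_ge0 ?lerDl//.
    exact: kernel_mass_le.
  rewrite /kernel_mass /d -powRrM mulVf ?gt_eqF// powRr1; last first.
    by rewrite divr_ge0 ?mulr_ge0// ltW.
  rewrite mulrA mulrCA divff ?gt_eqF// mulr1 mulfK// gt_eqF//.
near=> y.
have y1 : `|x - y| <= 1 by near: y; apply: cvgr_dist_le => //; exact: cvg_id.
have y2 : `|x - y| <= d by near: y; apply: cvgr_dist_le => //; exact: cvg_id.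
have yx : y <= `|x| + 1.
  by move: y1 (ler_norm x); rewrite ler_norml => /andP[]; lra.
have xx : x <= `|x| + 1 by move: (ler_norm x); lra.
have [xy|xy] := leP x y.
  rewrite distrC; apply: le_trans (H _ _ xy yx) _.
  by apply: dP; rewrite ?subr_ge0// -normrN opprB in y2 *; move: y2; rewrite ger0_norm ?subr_ge0.
apply: le_trans (H _ _ (ltW xy) xx) _.
by apply: dP; rewrite ?subr_ge0 ?(ltW xy)//; move: y2; rewrite ger0_norm ?subr_ge0// ltW.
Unshelve. all: by end_near. Qed.

End unnormalized_RL_integral.

(** * Composition of fractional integrals *)

Section affine_change_of_variable.
Context {R : realType}.
Notation mu := (@lebesgue_measure R).
Implicit Types (a b c t s h x y u l M T k : R) (f g : R -> R).

Let affine s k : R -> measurableTypeR R := fun x => s + k * x.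

Let measurable_affine s k : measurable_fun [set: measurableTypeR R] (affine s k).
Proof.
by apply: measurable_funD => //; exact: measurable_funM.
Qed.

Let affine_preimage s k x y : 0 < k ->
  affine s k @^-1` `]x, y]%classic = `](x - s) / k, (y - s) / k]%classic.
Proof.
move=> k0; apply/seteqP; split => z /=; rewrite !in_itv/= /affine;
  by rewrite ltr_pdivrMr// ler_pdivlMr// ltrBlDl lerBrDl (mulrC z).
Qed.

(** Both sides are measures which agree on half-open intervals. *)
Lemma lebesgue_measure_affine s k (A : set R) : 0 < k -> measurable A ->
  mu A = (k%:E * mu (affine s k @^-1` A))%E.
Proof.
move=> k0 mA.
pose nu : {measure set (measurableTypeR R) -> \bar R} :=
  mscale (NngNum (ltW k0)) (pushforward mu (affine s k)).
suff -> : mu A = nu (measurable_affine s k) A by [].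
apply: lebesgue_measure_unique => //= X [[x y]] _ <-.
rewrite /mscale /= /pushforward affine_preimage//= !lebesgue_measure_itv/=.
rewrite !lte_fin ltr_pM2r ?invr_gt0// ltrD2r.
case: ifPn => _; last by rewrite mule0.
rewrite -EFinM -EFinD; congr EFin.
by rewrite -mulrBl mulrCA divff ?gt_eqF// mulr1 opprB addrA subrK.
Qed.

Lemma ge0_integral_affine s k (D : set R) (f : R -> \bar R) : 0 < k ->
  measurable D -> measurable_fun D f -> (forall x, 0 <= f x)%E ->
  (\int[mu]_(x in D) f x =
   k%:E * \int[mu]_(x in affine s k @^-1` D) f (s + k * x)%R)%E.
Proof.
move=> k0 mD mf f0.
pose nu : {measure set (measurableTypeR R) -> \bar R} :=
  mscale (NngNum (ltW k0)) (pushforward mu (affine s k)).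
transitivity (\int[nu (measurable_affine s k)]_(x in D) f x)%E.
  apply: eq_measure_integral => A mA _.
  exact: lebesgue_measure_affine.
rewrite ge0_integral_mscale//=.
rewrite ge0_integral_pushforward//.
Qed.

Lemma ge0_integral_itv_affine s t (f : R -> \bar R) : s < t ->
  measurable_fun setT f -> (forall x, 0 <= f x)%E ->
  (\int[mu]_(x in `[s, t]) f x =
   (t - s)%:E * \int[mu]_(x in `[0%R, 1%R]) f (s + (t - s) * x)%R)%E.
Proof.
move=> st mf f0; have ts0 : 0 < t - s by rewrite subr_gt0.
rewrite (@ge0_integral_affine s (t - s) `[s, t])//; last exact: measurable_funTS.
congr (_ * integral _ _ _)%E.
apply/seteqP; split => z /=; rewrite !in_itv/= /affine.
  rewrite lerDl pmulr_rge0// => /andP[-> ] /=.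
  by rewrite -lerBrDl -{2}(mulr1 (t - s)) ler_pM2l.
move=> /andP[z0 z1]; rewrite lerDl pmulr_rge0// z0/=.
by rewrite -lerBrDl -[leRHS](mulr1 (t - s)) ler_pM2l.
Qed.

End affine_change_of_variable.

Section composition.
Context {R : realType}.
Notation mu := (@lebesgue_measure R).
Implicit Types (a b c t s h x y u l M T k : R) (f g : R -> R).

(** Tonelli for the triangle [0 <= s <= u <= t]. *)
Lemma fubini_triangle t (K : R -> R -> R) :
  measurable_fun [set: measurableTypeR R * measurableTypeR R] (fun z => K z.1 z.2) ->
  (forall u s, 0 <= K u s) ->
  (\int[mu]_(u in `[0%R, t]) \int[mu]_(s in `[0%R, u]) (K u s)%:E =
   \int[mu]_(s in `[0%R, t]) \int[mu]_(u in `[s, t]) (K u s)%:E)%E.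
Proof.
move=> mK K0.
pose T : set (measurableTypeR R * measurableTypeR R) :=
  [set z | [&& 0 <= z.2, z.2 <= z.1 & z.1 <= t]].
have mT : measurable T.
  have -> : T = (fun z => z.2) @^-1` `[0, +oo[ `&`
      ((fun z => z.1 - z.2) @^-1` `[0, +oo[ `&` (fun z => z.1) @^-1` `]-oo, t]).
    apply/seteqP; split=> -[u s]; rewrite /T/= !in_itv/= !andbT subr_ge0.
      by move=> /and3P[].
    by move=> [-> [-> ->]].
  apply: measurableI; last apply: measurableI.
  - rewrite -[X in measurable X]setTI.
    by apply: (measurable_snd) => //; exact: measurable_itv.
  - rewrite -[X in measurable X]setTI.
    by apply: (measurable_funB measurable_fst measurable_snd) => //.
  - rewrite -[X in measurable X]setTI.
    exact: (@measurable_fst _ _ (measurableTypeR R) (measurableTypeR R)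
      measurableT _ (measurable_itv `]-oo, t])).
pose F : measurableTypeR R * measurableTypeR R -> \bar R :=
  (fun z => (K z.1 z.2)%:E) \_ T.
have mF : measurable_fun setT F.
  have mKT : measurable_fun T (fun z => (K z.1 z.2)%:E).
    by apply: measurable_funTS; apply/measurable_EFinP.
  exact: ((measurable_restrictT _ mT).1 mKT).
have F0 z : (0 <= F z)%E.
  by rewrite /F patchE; case: ifP => // _; rewrite lee_fin.
have FT u s : F (u, s) = if [&& 0 <= s, s <= u & u <= t] then (K u s)%:E else 0%E.
  by rewrite /F patchE mem_setE/=.
transitivity (\int[mu]_u \int[mu]_s F (u, s))%E.
  rewrite integral_mkcond; apply: eq_integral => u _.
  rewrite patchE mem_setE in_itv/=.
  case: ifPn => [/andP[u0 ut]|H].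
    rewrite integral_mkcond; apply: eq_integral => s _.
    by rewrite FT patchE mem_setE in_itv/= ut andbT.
  rewrite integral0_eq// => s _; rewrite FT; case: ifPn => // /and3P[s0 su ut].
  by move: H; rewrite ut (le_trans s0).
rewrite (fubini_tonelli (m1 := mu) (m2 := mu) F mF F0).
rewrite [RHS]integral_mkcond; apply: eq_integral => s _.
rewrite [RHS]patchE mem_setE in_itv/=.
case: ifPn => [/andP[s0 st]|H].
  rewrite [RHS]integral_mkcond; apply: eq_integral => u _.
  by rewrite FT patchE mem_setE in_itv/= s0.
rewrite integral0_eq// => u _; rewrite FT; case: ifPn => // /and3P[s0 su ut].
by move: H; rewrite s0 (le_trans su).
Qed.

(** The Beta function at [(b, 1 - b)]. *)
Definition beta_integral b : \bar R :=
  (\int[mu]_(x in `[0%R, 1%R]) ((1 - x) `^ (- b) * x `^ (b - 1))%:E)%E.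

Lemma measurable_beta_kernel b s t :
  measurable_fun [set: measurableTypeR R]
    (fun u => (t - u) `^ (- b) * (u - s) `^ (b - 1)).
Proof.
apply: measurable_funM.
  apply: (@measurableT_comp _ _ _ _ _ _ (fun x : R => x `^ (- b))).
    exact: measurable_powR.
  exact: measurable_funB.
apply: (@measurableT_comp _ _ _ _ _ _ (fun x : R => x `^ (b - 1))).
  exact: measurable_powR.
exact: measurable_funB.
Qed.

(** The integrand is homogeneous of degree -1 in [(t - u, u - s)], so the affine
    map onto [0, 1] leaves the integral unchanged. *)
Lemma beta_integral_scale b s t : s < t ->
  (\int[mu]_(u in `[s, t]) ((t - u) `^ (- b) * (u - s) `^ (b - 1))%:E =
   beta_integral b)%E.
Proof.
move=> st; have ts0 : 0 < t - s by rewrite subr_gt0.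
rewrite ge0_integral_itv_affine//; last first.
- by move=> x; rewrite lee_fin mulr_ge0 ?powR_ge0.
- by apply/measurable_EFinP; exact: measurable_beta_kernel.
rewrite -ge0_integralZl//=; last 3 first.
- by apply/measurable_EFinP; apply: measurable_funTS;
    apply: (@measurableT_comp _ _ _ _ _ _ (fun u => (t - u) `^ (- b) * (u - s) `^ (b - 1)));
    [exact: measurable_beta_kernel|apply: measurable_funD => //; exact: measurable_funM].
- by move=> x _; rewrite lee_fin mulr_ge0 ?powR_ge0.
- by rewrite lee_fin ltW.
rewrite /beta_integral; apply: eq_integral => x; rewrite inE/= in_itv/= => /andP[x0 x1].
rewrite -EFinM; congr EFin.
have -> : t - (s + (t - s) * x) = (t - s) * (1 - x) by ring.
have -> : s + (t - s) * x - s = (t - s) * x by ring.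
rewrite !powRM ?(ltW ts0)// ?subr_ge0//.
have E : (t - s) * (t - s) `^ (- b) * (t - s) `^ (b - 1) = 1.
  rewrite -{1}(powRr1 (ltW ts0)) -!powRD ?(gt_eqF ts0) ?implybT//.
  by rewrite [X in _ `^ X](_ : _ = 0) ?powRr0//; ring.
transitivity ((t - s) * (t - s) `^ (- b) * (t - s) `^ (b - 1) *
    ((1 - x) `^ (- b) * x `^ (b - 1))); first by ring.
by rewrite E mul1r.
Qed.

Lemma kernel_integral_EFin b g u : 0 < b -> continuous g ->
  (\int[mu]_(s in `[0%R, u]) ((u - s) `^ (b - 1) * g s)%:E)%E =
  (kernel_integral b g u)%:E.
Proof.
move=> b0 cg; rewrite /kernel_integral /Rintegral fineK//.
apply: (@integrable_fin_num _ (measurableTypeR R)) => //.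
exact: integrable_kernelM.
Qed.

(** After exchanging the integrals, the inner one is the Beta integral over
    [s, t]; it degenerates at [s = t], whence the half-open interval. *)
Lemma kernel_integral_composition_ge0 b g t : 0 < b -> b < 1 -> continuous g ->
  (forall x, 0 <= g x) ->
  (\int[mu]_(u in `[0%R, t]) ((t - u) `^ (1 - b - 1) * kernel_integral b g u)%:E =
   \int[mu]_(s in `[0%R, t[) (beta_integral b * (g s)%:E))%E.
Proof.
move=> b0 b1 cg g0.
have mg : measurable_fun [set: measurableTypeR R] g by exact: continuous_measurable_fun.
have E1 : 1 - b - 1 = - b by ring.
pose K u s := (t - u) `^ (- b) * ((u - s) `^ (b - 1) * g s).
have mK : measurable_fun [set: measurableTypeR R * measurableTypeR R] (fun z => K z.1 z.2).
  apply: measurable_funM.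
    apply: (@measurableT_comp _ _ _ _ _ _ (fun x : R => x `^ (- b))).
      exact: measurable_powR.
    by apply: measurable_funB => //; exact: measurable_fst.
  apply: measurable_funM.
    apply: (@measurableT_comp _ _ _ _ _ _ (fun x : R => x `^ (b - 1))).
      exact: measurable_powR.
    by apply: measurable_funB; [exact: measurable_fst|exact: measurable_snd].
  by apply: (measurableT_comp mg); exact: measurable_snd.
have K0 u s : 0 <= K u s by rewrite !mulr_ge0 ?powR_ge0.
transitivity (\int[mu]_(u in `[0%R, t]) \int[mu]_(s in `[0%R, u]) (K u s)%:E)%E.
  apply: eq_integral => u _; rewrite E1 EFinM -kernel_integral_EFin//.
  rewrite -ge0_integralZl//=.
  - apply/measurable_EFinP; apply: measurable_funTS; apply: measurable_funM => //.
    apply: (@measurableT_comp _ _ _ _ _ _ (fun x : R => x `^ (b - 1))).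
      exact: measurable_powR.
    exact: measurable_funB.
  - by move=> x _; rewrite lee_fin mulr_ge0 ?powR_ge0.
  - by rewrite lee_fin powR_ge0.
rewrite fubini_triangle//.
have E s : s \in `[0%R, t[%classic ->
    (\int[mu]_(u in `[s, t]) (K u s)%:E = beta_integral b * (g s)%:E)%E.
  rewrite inE/= in_itv/= => /andP[s0 st].
  rewrite -(beta_integral_scale b st) -ge0_integralZr//=.
  - by apply: eq_integral => u _; rewrite /K mulrA.
  - by apply/measurable_EFinP; apply: measurable_funTS; exact: measurable_beta_kernel.
  - by move=> x _; rewrite lee_fin mulr_ge0 ?powR_ge0.
  - by rewrite lee_fin.
rewrite -integral_itv_bndo_bndc.
  exact: eq_integral.
apply: (eq_measurable_fun (fun s => beta_integral b * (g s)%:E)%E).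
  by move=> s /E ->.
apply: measurable_funTS; apply: measurable_funeM.
exact/measurable_EFinP.
Qed.

End composition.

Section abel_inversion.
Context {R : realType}.
Notation mu := (@lebesgue_measure R).
Implicit Types (a b c t s h x y u l M T k e r : R) (f g : R -> R).

Lemma powR_ge1 y r : 0 < y -> y < 1 -> r <= 0 -> 1 <= y `^ r.
Proof. by move=> y0 y1 r0; rewrite -(powRr0 y) ger_powR// y0/= ltW. Qed.

Lemma measurable_unit_beta_kernel b :
  measurable_fun [set: measurableTypeR R] (fun x => (1 - x) `^ (- b) * x `^ (b - 1)).
Proof.
apply: (eq_measurable_fun (fun x => (1 - x) `^ (- b) * (x - 0) `^ (b - 1))).
  by move=> x _; rewrite subr0.
exact: measurable_beta_kernel.
Qed.

Definition beta_cst b : R := fine (beta_integral b).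

(** Composing the two fractional integrals of the constant function 1 gives a
    real number, which is the Beta integral. *)
Lemma beta_integral_fin b : 0 < b -> b < 1 -> beta_integral b = (beta_cst b)%:E.
Proof.
move=> b0 b1; rewrite /beta_cst fineK//.
have c1 : continuous (cst 1 : R -> R) by move=> x; exact: cst_continuous.
have := @kernel_integral_composition_ge0 R b (cst 1) 1 b0 b1 c1 (fun=> ler01).
rewrite kernel_integral_EFin ?subr_gt0//; last first.
  by apply: continuous_kernel_integral => //; exact: ltW.
under eq_integral do rewrite mule1.
have -> : (\int[mu]_(_ in `[0%R, 1%R[) beta_integral b = beta_integral b)%E.
  rewrite integral_cst; last exact: measurable_itv.
  rewrite -[RHS]mule1; congr (_ * _)%E.
  by rewrite /= lebesgue_measure_itv/= lte_fin ltr01 sube0.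
by move=> <-.
Qed.

Lemma beta_cst_gt0 b : 0 < b -> b < 1 -> 0 < beta_cst b.
Proof.
move=> b0 b1; rewrite -lte_fin -beta_integral_fin//.
have mK := measurable_unit_beta_kernel b.
apply: (@lt_le_trans _ _ (\int[mu]_(x in `]0%R, 1%R[) (cst 1%:E) x)%E).
  by rewrite integral_cst//= lebesgue_measure_itv/= lte_fin ltr01 sube0 mule1 lte_fin.
apply: (@le_trans _ _ (\int[mu]_(x in `]0%R, 1%R[) ((1 - x) `^ (- b) * x `^ (b - 1))%:E)%E).
  apply: ge0_le_integral => //=.
  - by apply/measurable_EFinP; exact: measurable_funTS mK.
  move=> x; rewrite in_itv/= => /andP[x0 x1]; rewrite lee_fin.
  rewrite -[leLHS]mulr1 ler_pM// powR_ge1//.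
  - by rewrite subr_gt0.
  - by rewrite ltrBlDr ltrDl.
  - by rewrite oppr_le0 ltW.
  - by rewrite subr_le0 ltW.
rewrite /beta_integral; apply: ge0_subset_integral => //=.
- by apply/measurable_EFinP; exact: measurable_funTS mK.
- by move=> x _; rewrite lee_fin mulr_ge0 ?powR_ge0.
- exact: subset_itv_oo_cc.
Qed.

Lemma integrable_continuous g t : continuous g ->
  mu.-integrable `[0, t] (EFin \o g).
Proof.
move=> cg; apply: continuous_compact_integrable; first exact: segment_compact.
exact: continuous_subspaceT.
Qed.

(** The signed case follows from [g = (g + |g|) - |g|]. *)
Lemma kernel_integral_composition b g t : 0 < b -> b < 1 -> continuous g ->
  kernel_integral (1 - b) (kernel_integral b g) t =
  beta_cst b * \int[mu]_(s in `[0, t]) g s.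
Proof.
move=> b0 b1 cg.
have b10 : 0 < 1 - b by rewrite subr_gt0.
have cK f : continuous f -> continuous (kernel_integral b f).
  by move=> cf; apply: continuous_kernel_integral => //; exact: ltW.
suff pos f : continuous f -> (forall x, 0 <= f x) ->
    kernel_integral (1 - b) (kernel_integral b f) t =
    beta_cst b * \int[mu]_(s in `[0, t]) f s.
  have cn : continuous (fun s => `|g s|).
    by move=> x; apply: continuous_comp; [exact: cg|exact: norm_continuous].
  have cs : continuous (fun s => g s + `|g s|).
    by move=> x; apply: cvgD; [exact: cg|exact: cn].
  have e1 := pos _ cn (fun x => normr_ge0 _).
  have e2 := pos _ cs.
  have sp x : 0 <= g x + `|g x|.
    by have := ler_norm (- g x); rewrite normrN; lra.
  move: (e2 sp).
  under eq_kernel_integral do rewrite kernel_integralD//.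
  rewrite kernel_integralD ?cK//; [|exact: cK|exact: cK].
  rewrite RintegralD//; [|exact: integrable_continuous|exact: integrable_continuous].
  by rewrite e1 mulrDr => /addIr.
move=> cf f0; apply: EFin_inj.
rewrite -kernel_integral_EFin//; last exact: cK.
rewrite kernel_integral_composition_ge0//.
have mf : measurable_fun [set: measurableTypeR R] f by exact: continuous_measurable_fun.
rewrite integral_itv_bndo_bndc; last first.
  by apply: measurable_funTS; apply: measurable_funeM; exact/measurable_EFinP.
rewrite beta_integral_fin// ge0_integralZl//=; last 3 first.
- by apply: measurable_funTS; exact/measurable_EFinP.
- by move=> x _; rewrite lee_fin.
- by rewrite lee_fin ltW// beta_cst_gt0.
rewrite EFinM; congr (_ * _)%E.
rewrite /Rintegral fineK//; apply: (@integrable_fin_num _ (measurableTypeR R)) => //.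
exact: integrable_continuous.
Qed.

(** Composing with the fractional integral of complementary order shows that the
    primitive of [g] vanishes. *)
Lemma kernel_integral_eq0 b g T : 0 < b -> b < 1 -> continuous g ->
  (forall t, 0 <= t < T -> kernel_integral b g t = 0) ->
  forall t, 0 < t < T -> g t = 0.
Proof.
move=> b0 b1 cg H t /andP[t0 tT].
have B0 : beta_cst b != 0 by rewrite gt_eqF// beta_cst_gt0.
have I0 s : 0 <= s < T -> \int[mu]_(x in `[0, s]) g x = 0.
  move=> /andP[s0 sT]; apply: (mulfI B0).
  rewrite -kernel_integral_composition// mulr0.
  rewrite (@eq_kernel_integral _ _ _ (cst 0)).
    by rewrite kernel_integral_cst ?mul0r// subr_gt0.
  by move=> x /andP[x0 xs]; rewrite H// x0 (le_lt_trans xs).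
have tt1 : t < t + 1 by rewrite ltrDl.
have [dF Ft] := continuous_FTC1_closed tt1 (integrable_continuous _ cg) t0 (cg t).
rewrite -Ft derive1E (@near_eq_derive _ _ _ _ (cst 0)) ?derive_cst//.
near=> s; rewrite I0//; apply/andP; split.
- by apply: ltW; near: s; exact: lt_nbhsr.
- by near: s; exact: lt_nbhsl.
Unshelve. all: by end_near. Qed.

End abel_inversion.

(** * The maximum principle *)

Section maximum_principle.
Context {R : realType}.
Notation mu := (@lebesgue_measure R).
Implicit Types (a b c t s h x y u l M T k e : R) (f g : R -> R).

(** Bernoulli: [1 - y <= (1 - y) ^ b] for [y] in [0, 1]. *)
Lemma kernel_mass_increment_le b x h : 0 < b -> b <= 1 -> 0 < h -> h < x ->
  kernel_mass b x - kernel_mass b (x - h) <= x `^ (b - 1) / b * h.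
Proof.
move=> b0 b1 h0 hx; have x0 : 0 < x := lt_trans h0 hx.
have E : x - h = x * (1 - h / x) by rewrite mulrBr mulr1 mulrCA divff ?gt_eqF// mulr1.
have y0 : 0 < 1 - h / x by rewrite subr_gt0 ltr_pdivrMr// mul1r.
have y1 : 1 - h / x <= 1 by rewrite gerBl divr_ge0// ltW.
have H : 1 - h / x <= (1 - h / x) `^ b by rewrite ger1_powR// y0.
rewrite /kernel_mass E powRM// ?(ltW x0) ?(ltW y0)//.
have xb : x `^ (b - 1) = x `^ b / x by rewrite powRB ?(gt_eqF x0) ?implybT// powRr1 ?ltW.
have -> : x `^ (b - 1) / b * h = x `^ b * (h / x) / b.
  by rewrite xb; field; rewrite !gt_eqF.
rewrite -mulrBl ler_pM2r ?invr_gt0// -{1}(mulr1 (x `^ b)) -mulrBr.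
rewrite ler_wpM2l ?powR_ge0//; lra.
Qed.

Lemma kernel_mass_increment_ge b x h : 0 < b -> b <= 1 -> 0 < h -> h < x ->
  h * x `^ (b - 1) <= kernel_mass b x - kernel_mass b (x - h).
Proof.
move=> b0 b1 h0 hx; have x0 : 0 < x := lt_trans h0 hx.
rewrite -[X in kernel_mass b X - _](subr0 x) -Rintegral_kernel ?(ltW h0) ?(ltW hx)//.
have -> : h * x `^ (b - 1) = \int[mu]_(s in `[0, h]) (x `^ (b - 1)).
  rewrite Rintegral_cst//= lebesgue_measure_itv/= lte_fin h0 sube0 /= mulrC//.
apply: le_Rintegral => //.
- by apply: integrable_continuous => y; exact: cst_continuous.
- apply: (@integrableS _ (measurableTypeR R) R mu `[0, x]) => //.
    by apply: subset_itvl; rewrite bnd_simp ltW.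
  exact: integrable_kernel.
move=> s /=; rewrite in_itv/= => /andP[s0 sh].
have xs : 0 < x - s by rewrite subr_gt0 (le_lt_trans sh).
rewrite -(opprB 1 b) !powRN lef_pV2 ?posrE ?powR_gt0//.
by rewrite ge0_ler_powR ?nnegrE ?subr_ge0 ?(ltW x0)// ?gerBl// -subr_ge0 ltW.
Qed.

(** Hoelder continuity of order [b] is improved to [o (h ^ b)] from the left.  Up
    to a small error [g] equals [g t] on [t - eta, t], and the fractional integral
    of a constant is smooth away from 0.  The older values are seen through a
    kernel which is smooth there, and contribute [O (h)]. *)
Lemma kernel_integral_little_holder b g t e : 0 < b -> b < 1 -> continuous g ->
  0 < t -> 0 < e ->
  exists h0, [/\ 0 < h0, h0 <= t & forall h, 0 <= h < h0 ->
    kernel_integral b g t - kernel_integral b g (t - h) <= e * h `^ b].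
Proof.
move=> b0 b1 cg t0 e0.
(* With g within e1 of g t the recent part costs 2 e1 h^b / b = e h^b / 2. *)
pose e1 := e * b / 4.
have e10 : 0 < e1 by rewrite divr_gt0// mulr_gt0.
have [eta0 eta00 Heta] : exists2 d : R, 0 < d & forall s, `|t - s| < d -> `|g t - g s| <= e1.
  have /cvgrPdist_le /(_ _ e10) := cg t.
  by move=> [d /= d0 Hd]; exists d => // s /Hd.
pose eta := Num.min (eta0 / 2) t.
have eta_gt0 : 0 < eta by rewrite lt_min t0 divr_gt0.
have eta_t : eta <= t by rewrite ge_min lexx orbT.
have eta_eta0 : eta < eta0.
  by rewrite gt_min ltr_pdivrMr// ltr_pMr// ltr1n.
have [M [M0 gM]] := @continuous_bounded R g t cg.
pose K := (`|g t| + M) * (eta `^ (b - 1) / b).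
have K0 : 0 <= K by rewrite mulr_ge0// ?addr_ge0// divr_ge0 ?powR_ge0// ltW.
have b10 : 0 < 1 - b by rewrite subr_gt0.
(* The smooth part costs K h, which is at most e h^b / 2 for h < h1. *)
pose h1 := (e / 2 / (K + 1)) `^ (1 - b)^-1.
have h10 : 0 < h1 by rewrite powR_gt0// !divr_gt0// ltr_wpDl.
exists (Num.min eta h1); split.
- by rewrite lt_min eta_gt0.
- by rewrite ge_min eta_t.
move=> h /andP[]; rewrite le_eqVlt => /predU1P[<- _|h0].
  by rewrite subr0 subrr mulr_ge0 ?powR_ge0 ?ltW.
rewrite lt_min => /andP[heta hh1].
have gt_near s : t - eta <= s <= t -> g t - e1 <= g s <= g t + e1.
  move=> /andP[s1 s2]; rewrite -ler_distlC; apply: Heta.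
  by rewrite ger0_norm ?subr_ge0// (le_lt_trans _ eta_eta0)// lerBlDl -lerBlDr.
have a0 : 0 <= t - eta by rewrite subr_ge0.
have at0 : t - eta <= t - h by rewrite lerB// ltW.
have tht : t - h <= t by rewrite gerBl ltW.
have := @kernel_integral_increment_le R b g (t - eta) (t - h) t (g t + e1)
  (g t - e1) (- M) b0 (ltW b1) cg a0 at0 tht.
rewrite !subKr.
have -> : t - h - (t - eta) = eta - h by ring.
move=> H; have {H} := H _ _ _.
set P := kernel_mass b => H.
apply: le_trans (H _ _ _) _.
- move=> s /andP[s1 s2]; have /gt_near/andP[//] : t - eta <= s <= t.
  by rewrite s2 andbT (le_trans _ s1)// lerB// ltW.
- move=> s /andP[s1 s2]; have /gt_near/andP[//] : t - eta <= s <= t.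
  by rewrite s1/= (le_trans s2)// gerBl ltW.
- move=> s /andP[s1 s2]; have /gM : 0 <= s <= t.
    by rewrite s1 (le_trans s2)// gerBl ltW.
  by rewrite ler_norml => /andP[].
have D1 := kernel_mass_increment_le b0 (ltW b1) h0 heta.
have th0 : 0 <= t - h by rewrite subr_ge0 (le_trans (ltW heta)).
have D2 : P (t - h) <= P t by apply: kernel_mass_le => //; rewrite gerBl ltW.
have D3 : P (eta - h) <= P eta.
  by apply: kernel_mass_le => //; [rewrite subr_ge0 ltW|rewrite gerBl ltW].
have hb0 : 0 < h `^ b by rewrite powR_gt0.
have E1 : e1 * P h * 2 = e / 2 * h `^ b.
  by rewrite /e1 /P /kernel_mass; field; rewrite gt_eqF.
have E2 : K * h <= e / 2 * h `^ b.
  have hE : h = h `^ b * h `^ (1 - b).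
    rewrite -powRD ?(gt_eqF h0) ?implybT// [X in _ `^ X](_ : _ = 1) ?powRr1 ?ltW//.
    by ring.
  have Hh : h `^ (1 - b) <= e / 2 / (K + 1).
    have -> : e / 2 / (K + 1) = h1 `^ (1 - b).
      rewrite /h1 -powRrM mulVf ?gt_eqF// powRr1//.
      by rewrite !divr_ge0 ?ltW// ltr_wpDl.
    by rewrite ge0_ler_powR ?nnegrE ?(ltW h0) ?(ltW h10) ?(ltW b10) ?(ltW hh1).
  rewrite [X in K * X]hE mulrCA [leRHS]mulrC ler_pM2l//.
  apply: (@le_trans _ _ (K * (e / 2 / (K + 1)))); first exact: ler_wpM2l.
  rewrite mulrA ler_pdivrMr ?ltr_wpDl// mulrC ler_pM2l ?divr_gt0//.
  by rewrite lerDl.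
have F1 : (g t - e1) * (P eta - P (eta - h)) <= `|g t| * (P eta - P (eta - h)).
  rewrite ler_wpM2r ?subr_ge0//.
  by rewrite (le_trans _ (ler_norm _))// gerBl ltW.
have F2 : 0 <= M * (P t - P (t - h)) by rewrite mulr_ge0// subr_ge0.
have F3 : (`|g t| + M) * (P eta - P (eta - h)) <= K * h.
  by rewrite /K -mulrA ler_wpM2l// addr_ge0.
suff arith p pe peh pt pth hb kh A G N a c : a * p * 2 = c / 2 * hb ->
    kh <= c / 2 * hb -> (G - a) * (pe - peh) <= A * (pe - peh) ->
    0 <= N * (pt - pth) -> (A + N) * (pe - peh) <= kh ->
    (G + a) * p - (G - a) * (peh - pe + p) - - N * (pth - peh - (pt - pe)) <= c * hb.
  exact: arith E1 E2 F1 F2 F3.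
by clear; lra.
Qed.

(** The increment over [t - h, t] of the integral [J] of order [1 - b] of
    [I = kernel_integral b g] is [beta_cst b] times that of the primitive of [g].
    It is also bounded below by [I t] times the increment of the mass, up to
    [o (h)], because replacing [I] by its maximum in the past only lowers it. *)
Lemma kernel_integral_max_principle b g t : 0 < b -> b < 1 -> continuous g ->
  0 < t ->
  (forall s, 0 <= s <= t -> kernel_integral b g s <= kernel_integral b g t) ->
  kernel_integral b g t * t `^ (- b) <= beta_cst b * g t.
Proof.
move=> b0 b1 cg t0 Imax.
set I := kernel_integral b g in Imax *.
have B0 := beta_cst_gt0 b0 b1.
have b10 : 0 < 1 - b by rewrite subr_gt0.
have b11 : 1 - b <= 1 by rewrite gerBl ltW.
have cI : continuous I by apply: continuous_kernel_integral => //; exact: ltW.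
have It0 : 0 <= I t.
  by rewrite -(kernel_integral_le0 b g (lexx 0)) Imax// lexx ltW.
apply/ler_addgt0Pr => e e0.
pose C := beta_cst b + (1 - b)^-1.
have C0 : 0 < C by rewrite addr_gt0// invr_gt0.
pose e1 := e / C.
have e10 : 0 < e1 by rewrite divr_gt0.
have [h0 [h00 h0t H]] := kernel_integral_little_holder b0 b1 cg t0 e10.
have [d d0 Hd] : exists2 d : R, 0 < d & forall s, `|t - s| < d -> `|g t - g s| <= e1.
  have /cvgrPdist_le /(_ _ e10) := cg t.
  by move=> [d /= d0 Hd]; exists d => // s /Hd.
pose h := Num.min h0 d / 2.
have h_gt0 : 0 < h by rewrite divr_gt0// lt_min h00.
have hh0 : h < h0.
  by rewrite ltr_pdivrMr// gt_min; apply/orP; left; rewrite ltr_pMr// ltr1n.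
have hd : h < d.
  by rewrite ltr_pdivrMr// gt_min; apply/orP; right; rewrite ltr_pMr// ltr1n.
have ht : h < t := lt_le_trans hh0 h0t.
pose J := kernel_integral (1 - b) I.
have th : t - h <= t by rewrite gerBl ltW.
have th0 : 0 <= t - h by rewrite subr_ge0 ltW.
have up : J t - J (t - h) <= beta_cst b * (h * (g t + e1)).
  rewrite /J !kernel_integral_composition// -mulrBr ler_pM2l//.
  rewrite (@Rintegral_itv_split _ _ 0 (t - h) t)//; last exact: integrable_continuous.
  rewrite addrAC subrr add0r.
  have -> : h * (g t + e1) = \int[mu]_(s in `[t - h, t]) (g t + e1).
    rewrite Rintegral_cst//= lebesgue_measure_itv/= lte_fin ltrBlDr ltrDl h_gt0/=.
    by rewrite subKr mulrC.
  have S : `[t - h, t] `<=` `[0, t] by apply: subset_itvr; rewrite bnd_simp.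
  apply: le_Rintegral => //.
  - apply: (@integrableS _ (measurableTypeR R) R mu `[0, t]) => //.
    exact: integrable_continuous.
  - apply: (@integrableS _ (measurableTypeR R) R mu `[0, t]) => //.
    by apply: integrable_continuous => y; exact: cst_continuous.
  move=> s /=; rewrite in_itv/= => /andP[s1 s2].
  have : `|t - s| < d.
    by rewrite ger0_norm ?subr_ge0// (le_lt_trans _ hd)// lerBlDl -lerBlDr.
  by move=> /Hd; rewrite ler_distlC => /andP[].
have cNI : continuous (fun s => - I s) by move=> x; apply: continuousN; exact: cI.
have low : I t * (h * t `^ (- b)) - e1 * (h / (1 - b)) <= J t - J (t - h).
  have := @kernel_integral_increment_le R (1 - b) (fun s => - I s) 0 (t - h) t
    (- (I t - e1 * h `^ b)) (- I t) (- I t) b10 b11 cNI (lexx _) th0 th.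
  rewrite !kernel_integralN// -/J subKr !subr0 => HH.
  have {HH} := HH _ _ _.
  set P := kernel_mass (1 - b) => HH.
  have {HH} : - J t - - J (t - h) <= - (I t - e1 * h `^ b) * P h -
    - I t * (P (t - h) - P t + P h) - - I t * (P (t - h) - P (t - h) - (P t - P t)).
    apply: HH.
    - move=> s /andP[s1 s2]; rewrite lerN2.
      have hs : 0 <= t - s < h0.
        by rewrite subr_ge0 s2/= (le_lt_trans _ hh0)// lerBlDl -lerBlDr.
      have := H _ hs; rewrite -/I subKr lerBlDl -lerBlDr; apply: le_trans.
      rewrite lerB// ler_pM2l// ge0_ler_powR ?nnegrE ?(ltW b0) ?(ltW h_gt0) ?subr_ge0//.
      by rewrite lerBlDl -lerBlDr.
    - by move=> s /andP[s1 s2]; rewrite lerN2 Imax// s1 (le_trans s2).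
    - move=> s /andP[s1 s2]; rewrite lerN2 Imax// s1 (le_trans s2)// ltW//.
  have D := kernel_mass_increment_ge b10 b11 h_gt0 ht.
  have E : h `^ b * P h = h / (1 - b).
    rewrite /P /kernel_mass mulrA -powRD ?(gt_eqF h_gt0) ?implybT//.
    by rewrite [X in _ `^ X](_ : _ = 1) ?powRr1 ?ltW//; ring.
  have {D} := ler_wpM2l It0 D; rewrite -/P.
  have -> : 1 - b - 1 = - b by ring.
  have {E} : e1 * (h `^ b * P h) = e1 * (h / (1 - b)) by rewrite E.
  suff arith i a hb ph x pt pth jt jth w :
      a * (hb * ph) = w -> x <= i * (pt - pth) ->
      - jt - - jth <= - (i - a * hb) * ph - - i * (pth - pt + ph) - - i * (pth - pth - (pt - pt)) ->
      x - w <= jt - jth by exact: arith.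
  by clear; lra.
have -> : e = e1 * C by rewrite /e1 divfK// gt_eqF.
have := le_trans low up.
rewrite -(ler_pM2r h_gt0 (_ * _)) /C.
suff arith i x z a w B G : i * (x * z) - a * (x * w) <= B * (x * (G + a)) ->
    i * z * x <= (B * G + a * (B + w)) * x by exact: arith.
by clear; lra.
Qed.

Lemma Rintegral_expR k c : 0 < k -> 0 < c ->
  \int[mu]_(s in `[0, c]) expR (k * s) = (expR (k * c) - 1) / k.
Proof.
move=> k0 c0.
have dE x : is_derive x 1 (fun s => expR (k * s) / k) (expR (k * x)).
  have H2 : is_derive x 1 (fun s => k * s) (k * 1) by exact: is_deriveZ.
  have H3 := @is_derive1_comp _ expR (fun s => k * s) x _ _ (is_derive_expR (k * x)) H2.
  have H4 : is_derive x 1 (fun s => k^-1 * (expR \o (fun s => k * s)) s)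
    (k^-1 * (expR (k * x) * (k * 1))) by exact: is_deriveZ.
  have -> : (fun s => expR (k * s) / k) = (fun s => k^-1 * (expR \o (fun s => k * s)) s).
    by apply/funext => s /=; rewrite mulrC.
  have -> // : expR (k * x) = k^-1 * (expR (k * x) * (k * 1)).
  by rewrite mulr1 mulrCA mulVf ?gt_eqF// mulr1.
have cE x : {for x, continuous (fun s => expR (k * s) / k)}.
  by apply: differentiable_continuous; apply/derivable1_diffP; apply: ex_derive.
have cE1 : continuous (fun s => expR (k * s)).
  move=> x; apply: continuous_comp; last exact: continuous_expR.
  by apply: cvgM; [exact: cvg_cst|exact: cvg_id].
rewrite /Rintegral (@continuous_FTC2 _ _ (fun s => expR (k * s) / k) 0 c)//.
- by rewrite /= mulr0 expR0 mulrBl.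
- exact: continuous_subspaceT.
- split.
  + by move=> x _; exact: ex_derive.
  + by apply: cvg_at_right_filter; exact: cE.
  + by apply: cvg_at_left_filter; exact: cE.
- by move=> x _; rewrite derive1E; apply: derive_val.
Qed.

(** The exponential is split at distance [eta] from [t]: the last part is small
    with [eta], the first one with [1 / k].  This makes the Volterra operator a
    contraction for the norm weighted by [expR (- k * t)]. *)
Lemma kernel_integral_expR_small b q : 0 < b -> b <= 1 -> 0 < q ->
  exists2 k, 0 < k & forall t, 0 <= t ->
    kernel_integral b (fun s => expR (k * s)) t <= q * expR (k * t).
Proof.
move=> b0 b1 q0.
pose eta := (q / 2 * b) `^ b^-1.
have q2b : 0 < q / 2 * b by rewrite mulr_gt0// divr_gt0.
have eta0 : 0 < eta by rewrite powR_gt0.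
have Peta : kernel_mass b eta = q / 2.
  by rewrite /kernel_mass /eta -powRrM mulVf ?gt_eqF// powRr1 ?(ltW q2b)// mulfK// gt_eqF.
pose k := eta `^ (b - 1) / (q / 2).
have k0 : 0 < k by rewrite !divr_gt0 ?powR_gt0.
have cE1 : continuous (fun s => expR (k * s)).
  move=> x; apply: continuous_comp; last exact: continuous_expR.
  by apply: cvgM; [exact: cvg_cst|exact: cvg_id].
exists k => // t t0.
have expo s : s <= t -> expR (k * s) <= expR (k * t).
  by move=> st; rewrite ler_expR ler_pM2l.
have [teta|etat] := leP t eta.
  apply: (@le_trans _ _ (expR (k * t) * (kernel_mass b (t - 0) - kernel_mass b (t - t)))).
    by apply: Rintegral_kernelM_le => // s /andP[_]; exact: expo.
  rewrite subr0 subrr kernel_mass0// subr0 mulrC ler_wpM2r ?expR_ge0//.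
  apply: (@le_trans _ _ (kernel_mass b eta)); first exact: kernel_mass_le.
  by rewrite Peta ler_pdivrMr// ler_pMr// ler1n.
have te0 : 0 < t - eta by rewrite subr_gt0.
have te : t - eta <= t by rewrite gerBl ltW.
rewrite /kernel_integral (@Rintegral_itv_split _ _ 0 (t - eta) t) ?(ltW te0)//; last first.
  exact: integrable_kernelM.
have H2 : \int[mu]_(s in `[t - eta, t]) ((t - s) `^ (b - 1) * expR (k * s)) <= q / 2 * expR (k * t).
  apply: le_trans (Rintegral_kernelM_le (u := expR (k * t)) b0 cE1 te (lexx _) _) _.
    by move=> s /andP[_]; exact: expo.
  by rewrite subKr subrr kernel_mass0// subr0 Peta mulrC.
have H1 : \int[mu]_(s in `[0, t - eta]) ((t - s) `^ (b - 1) * expR (k * s)) <= q / 2 * expR (k * t).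
  apply: (@le_trans _ _ (\int[mu]_(s in `[0, t - eta]) (eta `^ (b - 1) * expR (k * s)))).
    apply: le_Rintegral => //.
    - exact: integrable_kernelM.
    - apply: (@integrable_continuous R (fun s => eta `^ (b - 1) * expR (k * s))).
      by move=> x; apply: cvgM; [exact: cvg_cst|exact: cE1].
    move=> s /=; rewrite in_itv/= => /andP[s0 s1].
    rewrite ler_wpM2r ?expR_ge0//.
    have es : eta <= t - s by rewrite lerBrDr -lerBrDl.
    rewrite -(opprB 1 b) !powRN lef_pV2 ?posrE ?powR_gt0// ?(lt_le_trans eta0)//.
    by rewrite ge0_ler_powR ?nnegrE ?subr_ge0 ?(ltW eta0)// -subr_ge0 (le_trans (ltW eta0)).
  rewrite RintegralZl//; last exact: (@integrable_continuous R _ _ cE1).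
  rewrite Rintegral_expR//.
  have -> : eta `^ (b - 1) = k * (q / 2) by rewrite /k divfK// gt_eqF// divr_gt0.
  have -> : k * (q / 2) * ((expR (k * (t - eta)) - 1) / k) =
      q / 2 * (expR (k * (t - eta)) - 1) by field; rewrite gt_eqF.
  by rewrite ler_pM2l ?divr_gt0// lerBlDr ler_wpDr// expo.
have -> : q = q / 2 + q / 2 by rewrite -splitr.
by rewrite mulrDl lerD.
Qed.

End maximum_principle.

(** * The Caputo equation as a Volterra equation *)

Section volterra_equivalence.
Context {R : realType}.
Notation mu := (@lebesgue_measure R).
Implicit Types (a b c t s h x y u l M T k e : R) (f g w : R -> R).

(** Positivity needs the integral to be finite: near 0 the integrand is dominated
    by that of the Beta integral, and beyond 1 by the exponential density. *)
Lemma Gamma_gt0 a : 0 < a -> a < 1 -> 0 < Gamma a.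
Proof.
move=> a0 a1.
pose f := fun s => s `^ (a - 1) * expR (- s).
have mf (A : set R) : measurable_fun A f.
  apply: measurable_funTS; apply: measurable_funM; first exact: measurable_powR.
  apply: continuous_measurable_fun => x.
  by apply: continuous_comp; [exact: opp_continuous|exact: continuous_expR].
have f0 s : 0 <= f s by rewrite mulr_ge0 ?powR_ge0 ?expR_ge0.
pose ker := fun x => (1 - x) `^ (- a) * x `^ (a - 1).
have mK : measurable_fun [set: measurableTypeR R] ker by exact: measurable_unit_beta_kernel.
have ker0 x : 0 <= ker x by rewrite mulr_ge0 ?powR_ge0.
pose f1 : R -> \bar R := (EFin \o ker) \_ `[0%R, 1%R].
pose f2 : R -> \bar R := EFin \o exponential_pdf 1.
have mf1 : measurable_fun [set: measurableTypeR R] f1.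
  apply: ((measurable_restrictT _ (measurable_itv `[0%R, 1%R])).1 _).
  by apply: measurable_funTS; exact/measurable_EFinP.
have mf2 : measurable_fun [set: measurableTypeR R] f2.
  by apply/measurable_EFinP; exact: measurable_exponential_pdf.
have f10 x : (0 <= f1 x)%E by apply: erestrict_ge0 => y _; rewrite lee_fin.
have f20 x : (0 <= f2 x)%E by rewrite lee_fin exponential_pdf_ge0.
have fin : (\int[mu]_(s in `]0%R, +oo[) (f s)%:E < +oo)%E.
  apply: (@le_lt_trans _ _ (\int[mu]_(s in `]0%R, +oo[) (f1 s + f2 s))%E).
    apply: ge0_le_integral => //=.
    - by move=> x _; rewrite lee_fin.
    - by apply/measurable_EFinP; exact: mf.
    - by apply: measurable_funTS; exact: emeasurable_funD.
    move=> s; rewrite in_itv/= andbT => s0.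
    have pdfE : exponential_pdf 1 s = expR (- s).
      by rewrite exponential_pdfE ?ltW//= mul1r mulN1r.
    have [s1|s1] := ltP s 1.
      apply: (@le_trans _ _ (f1 s)); last by rewrite leeDl.
      rewrite /f1 patchE mem_setE in_itv/= (ltW s0) (ltW s1)/= lee_fin /f /ker mulrC.
      rewrite ler_wpM2r ?powR_ge0// (@le_trans _ _ 1)//.
        by rewrite -expR0 ler_expR oppr_le0 ltW.
      by apply: powR_ge1; rewrite ?subr_gt0 ?ltrBlDr ?ltrDl ?oppr_le0 ?(ltW a0).
    apply: (@le_trans _ _ (f2 s)); last by rewrite leeDr.
    rewrite /f2/= lee_fin pdfE /f ler_piMl ?expR_ge0//.
    by rewrite -[leRHS](powRr0 s) ler_powR// subr_le0 ltW.
  rewrite ge0_integralD//=; last 2 first.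
  - exact: measurable_funTS.
  - exact: measurable_funTS.
  apply: lte_add_pinfty.
    apply: (@le_lt_trans _ _ (\int[mu]_s f1 s)%E).
      by apply: ge0_subset_integral => //=.
    by rewrite -integral_mkcond -/(beta_integral a) beta_integral_fin// ltry.
  apply: (@le_lt_trans _ _ (\int[mu]_s f2 s)%E).
    by apply: ge0_subset_integral => //=.
  by rewrite integral_exponential_pdf// ltry.
have pos : ((expR (- 1))%:E <= \int[mu]_(s in `]0%R, +oo[) (f s)%:E)%E.
  apply: (@le_trans _ _ (\int[mu]_(x in `]0%R, 1%R[) (cst (expR (- 1))%:E) x)%E).
    by rewrite integral_cst//= lebesgue_measure_itv/= lte_fin ltr01 sube0 mule1.
  apply: (@le_trans _ _ (\int[mu]_(x in `]0%R, 1%R[) (f x)%:E)%E).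
    apply: ge0_le_integral => //=.
    - by apply/measurable_EFinP; exact: mf.
    move=> x; rewrite in_itv/= => /andP[x0 x1]; rewrite lee_fin /f.
    rewrite -[leLHS]mul1r ler_pM ?expR_ge0//.
      by apply: powR_ge1; rewrite // subr_le0 ltW.
    by rewrite ler_expR lerN2 ltW.
  apply: ge0_subset_integral => //=.
  - by apply/measurable_EFinP; exact: mf.
  - by move=> x _; rewrite lee_fin.
  - by apply: subset_itvl.
rewrite /Gamma /Rintegral fine_gt0// fin andbT.
by apply: lt_le_trans pos; rewrite lte_fin expR_gt0.
Qed.

(** Equal to [(Gamma b)^-1], as [beta_cst b = Gamma b * Gamma (1 - b)]. *)
Definition volterra_cst b : R := Gamma (1 - b) / beta_cst b.

Lemma volterra_cst_gt0 b : 0 < b -> b < 1 -> 0 < volterra_cst b.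
Proof.
move=> b0 b1; rewrite divr_gt0 ?beta_cst_gt0//.
by rewrite Gamma_gt0 ?subr_gt0// gtrBl.
Qed.

Lemma RL_integralE a g t : RL_integral a g t = (Gamma a)^-1 * kernel_integral a g t.
Proof. by []. Qed.

Lemma RL_integral_volterra b g t : 0 < b -> b < 1 -> continuous g ->
  RL_integral (1 - b) (fun s => volterra_cst b * kernel_integral b g s) t =
  \int[mu]_(s in `[0, t]) g s.
Proof.
move=> b0 b1 cg; rewrite RL_integralE kernel_integralZ ?subr_gt0//; last first.
  by apply: continuous_kernel_integral => //; exact: ltW.
rewrite kernel_integral_composition// /volterra_cst.
have G0 : 0 < Gamma (1 - b) by rewrite Gamma_gt0 ?subr_gt0// gtrBl.
by field; rewrite !gt_eqF// beta_cst_gt0.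
Qed.

Lemma RL_derive_volterra b g t : 0 < b -> b < 1 -> continuous g -> 0 < t ->
  RL_derivable b (fun s => volterra_cst b * kernel_integral b g s) t /\
  RL_derive b (fun s => volterra_cst b * kernel_integral b g s) t = g t.
Proof.
move=> b0 b1 cg t0.
rewrite /RL_derivable /RL_derive.
have -> : RL_integral (1 - b) (fun s => volterra_cst b * kernel_integral b g s) =
    (fun t => \int[mu]_(s in `[0, t]) g s).
  by apply/funext => x; exact: RL_integral_volterra.
have tt1 : t < t + 1 by rewrite ltrDl.
exact: (continuous_FTC1_closed tt1 (integrable_continuous _ cg) t0 (cg t)).
Qed.

Lemma continuous_primitive g : continuous g ->
  continuous (fun t => \int[mu]_(s in `[0, t]) g s).
Proof.
move=> cg.
have -> : (fun t => \int[mu]_(s in `[0, t]) g s) = kernel_integral 1 g.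
  apply/funext => t; apply: eq_Rintegral => s _.
  by rewrite subrr powRr0 mul1r.
by apply: continuous_kernel_integral.
Qed.

(** The integral of order [1 - b] of [w] and the primitive of [g] have the same
    derivative and vanish at 0, so they agree.  The primitive is also the integral
    of order [1 - b] of the right-hand side below, and that integral is injective. *)
Lemma volterra_of_RL_derive b g w T : 0 < b -> b < 1 ->
  continuous g -> continuous w -> w 0 = 0 ->
  (forall t, 0 < t < T -> RL_derivable b w t /\ RL_derive b w t = g t) ->
  forall t, 0 <= t < T -> w t = volterra_cst b * kernel_integral b g t.
Proof.
move=> b0 b1 cg cw w0 H t /andP[].
rewrite le_eqVlt => /predU1P[<- _|t0 tT].
  by rewrite kernel_integral_le0// mulr0.
have b10 : 0 < 1 - b by rewrite subr_gt0.
have b11 : 1 - b <= 1 by rewrite gerBl ltW.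
have b1lt : 1 - b < 1 by rewrite gtrBl.
have G0 : 0 < Gamma (1 - b) by rewrite Gamma_gt0.
have cK : continuous (kernel_integral b g).
  by apply: continuous_kernel_integral => //; exact: ltW.
pose F t := \int[mu]_(s in `[0, t]) g s.
pose J := RL_integral (1 - b) w.
have cJ : continuous J.
  move=> x; apply: cvgM; first exact: cvg_cst.
  exact: continuous_kernel_integral.
have cF : continuous F by exact: continuous_primitive.
have JF s : 0 <= s < T -> J s = F s.
  move=> /andP[]; rewrite le_eqVlt => /predU1P[<- _|s0 sT].
    by rewrite /J RL_integralE kernel_integral_le0// mulr0 /F set_itv1 Rintegral_set1.
  have dJF x : x \in `]0, s[ -> is_derive x 1 (J - F) 0.
    rewrite in_itv/= => /andP[x0 xs].
    have [dJ eJ] : RL_derivable b w x /\ RL_derive b w x = g x.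
      by apply: H; rewrite x0 (lt_trans xs).
    have xx1 : x < x + 1 by rewrite ltrDl.
    have [dF eF] := continuous_FTC1_closed xx1 (integrable_continuous _ cg) x0 (cg x).
    have iJ : is_derive x 1 J (g x) by split; [exact: dJ|rewrite -derive1E].
    have iF : is_derive x 1 F (g x) by split; [exact: dF|rewrite -derive1E].
    rewrite -[X in is_derive _ _ _ X](subrr (g x)); exact: is_deriveB.
  have cJF : {within `[0, s], continuous (J - F)}.
    by apply: continuous_subspaceT => x; apply: cvgB; [exact: cJ|exact: cF].
  have [c _] := MVT s0 dJF cJF.
  rewrite mul0r => /eqP; rewrite subr_eq0 => /eqP.
  have -> : (J - F) 0 = J 0 - F 0 by [].
  have -> : J 0 = 0 by rewrite /J RL_integralE kernel_integral_le0// mulr0.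
  have -> : F 0 = 0 by rewrite /F set_itv1 Rintegral_set1.
  rewrite subrr.
  by move=> /eqP; rewrite subr_eq0 => /eqP.
pose u := fun s => w s + - volterra_cst b * kernel_integral b g s.
have cu : continuous u.
  move=> x; apply: cvgD; first exact: cw.
  by apply: cvgM; [exact: cvg_cst|exact: cK].
suff : u t = 0 by rewrite /u mulNr => /eqP; rewrite subr_eq0 => /eqP.
apply: (@kernel_integral_eq0 R (1 - b) u T) => //; last by rewrite t0.
move=> s /andP[s0 sT].
have cvK : continuous (fun s => - volterra_cst b * kernel_integral b g s).
  by move=> x; apply: cvgM; [exact: cvg_cst|exact: cK].
rewrite /u kernel_integralD// kernel_integralZ// kernel_integral_composition//.
have := JF s; rewrite s0 sT => /(_ isT); rewrite /J RL_integralE => JFs.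
have -> : kernel_integral (1 - b) w s = Gamma (1 - b) * F s.
  by rewrite -JFs mulrA divff ?mul1r// gt_eqF.
rewrite /F /volterra_cst; set I := Rintegral _ _ _.
by field; rewrite gt_eqF// beta_cst_gt0.
Qed.

Lemma eq_RL_integral a f g t : (forall s, 0 <= s <= t -> f s = g s) ->
  RL_integral a f t = RL_integral a g t.
Proof. by move=> fg; rewrite !RL_integralE (eq_kernel_integral _ fg). Qed.

Lemma eq_RL_derive a f g t T : 0 < t < T ->
  (forall s, 0 <= s < T -> f s = g s) ->
  (RL_derivable a f t -> RL_derivable a g t) /\ RL_derive a f t = RL_derive a g t.
Proof.
move=> /andP[t0 tT] fg.
have nE : {near t, RL_integral (1 - a) f =1 RL_integral (1 - a) g}.
  near=> x; apply: eq_RL_integral => s /andP[s0 sx]; apply: fg; rewrite s0 (le_lt_trans sx)//.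
  by near: x; exact: lt_nbhsl.
split; first exact: near_eq_derivable.
by rewrite /RL_derive !derive1E; exact: near_eq_derive.
Unshelve. all: by end_near. Qed.

End volterra_equivalence.

(** * Global solutions of Lipschitz Volterra equations *)

Section volterra_equation.
Context {R : realType} (d : nat).
Notation mu := (@lebesgue_measure R).
Implicit Types (a b c t s h l M T k e C A : R) (x : 'rV[R]_d).
Implicit Types (X Y : R -> 'rV[R]_d) (F : 'rV[R]_d -> 'rV[R]_d).

Definition coordwise_continuous X := forall i, continuous (fun t => X t 0 i).

(** Lipschitz for the sup norm. *)
Definition coordwise_lipschitz F L := forall (u v : 'rV[R]_d) (D : R), 0 <= D ->
  (forall i, `|u 0 i - v 0 i| <= D) -> forall i, `|F u 0 i - F v 0 i| <= L * D.

Lemma coordwise_lipschitz_comp F L X : 0 <= L -> coordwise_lipschitz F L ->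
  coordwise_continuous X -> coordwise_continuous (F \o X).
Proof.
move=> L0 hF cX i t; apply/cvgrPdist_le => /= e e0.
have e1 : 0 < e / (L + 1) by rewrite divr_gt0// ltr_wpDl.
have nX : \forall s \near t, forall j, `|X t 0 j - X s 0 j| <= e / (L + 1).
  apply: (@filter_forall R 'I_d (fun j s => `|X t 0 j - X s 0 j| <= e / (L + 1))
    (nbhs t) (nbhs_filter t)) => j.
  by have /cvgrPdist_le := cX j t; apply.
near=> s.
have Hs : forall j, `|X t 0 j - X s 0 j| <= e / (L + 1) by near: s.
apply: le_trans (hF _ _ _ (ltW e1) Hs i) _.
by rewrite mulrA ler_pdivrMr ?ltr_wpDl// mulrC ler_pM2l// lerDl.
Unshelve. all: by end_near. Qed.

Lemma kernel_integral_dist b (f g h : R -> R) t : 0 < b ->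
  continuous f -> continuous g -> continuous h ->
  (forall s, 0 <= s <= t -> `|f s - g s| <= h s) ->
  `|kernel_integral b f t - kernel_integral b g t| <= kernel_integral b h t.
Proof.
move=> b0 cf cg ch H.
have H' s : 0 <= s <= t -> g s - h s <= f s <= g s + h s.
  by move=> /H; rewrite ler_distl.
rewrite ler_distl; apply/andP; split.
  rewrite -kernel_integralN// -kernel_integralD//.
    apply: le_kernel_integral => //.
      by move=> x; apply: cvgB; [exact: cg|exact: ch].
    by move=> s /H' /andP[].
  by move=> x; apply: cvgN; exact: ch.
rewrite -kernel_integralD//; apply: le_kernel_integral => //.
  by move=> x; apply: cvgD; [exact: cg|exact: ch].
by move=> s /H' /andP[].
Qed.

Definition volterra_map b F x0 X : R -> 'rV[R]_d := fun t =>
  \row_i (x0 0 i + volterra_cst b * kernel_integral b (fun s => F (X s) 0 i) t).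

Lemma volterra_map_le0 b F x0 X t : t <= 0 -> volterra_map b F x0 X t = x0.
Proof.
move=> t0; apply/rowP => i; rewrite mxE kernel_integral_le0// mulr0 addr0//.
Qed.

Lemma volterra_map_continuous b F L x0 X : 0 < b -> b < 1 -> 0 <= L ->
  coordwise_lipschitz F L -> coordwise_continuous X ->
  coordwise_continuous (volterra_map b F x0 X).
Proof.
move=> b0 b1 L0 hF cX i.
have -> : (fun t => volterra_map b F x0 X t 0 i) =
    (fun t => x0 0 i + volterra_cst b * kernel_integral b (fun s => F (X s) 0 i) t).
  by apply/funext => t; rewrite mxE.
move=> t; apply: cvgD; first exact: cvg_cst.
apply: cvgM; first exact: cvg_cst.
apply: continuous_kernel_integral => //; first exact: ltW.
exact: (coordwise_lipschitz_comp L0 hF cX).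
Qed.

(** Bielecki's weighted norm: for [k] large the Volterra operator halves
    distances measured with the weight [expR (k * t)], on all of [0, +oo) at
    once. *)
Lemma volterra_map_contraction b F L x0 : 0 < b -> b < 1 -> 0 <= L ->
  coordwise_lipschitz F L ->
  exists2 k : R, 0 < k & forall X Y C t, coordwise_continuous X ->
    coordwise_continuous Y -> 0 <= C ->
    (forall s, 0 <= s <= t -> forall i, `|X s 0 i - Y s 0 i| <= C * expR (k * s)) ->
    forall i, `|volterra_map b F x0 X t 0 i - volterra_map b F x0 Y t 0 i|
              <= C / 2 * expR (k * t).
Proof.
move=> b0 b1 L0 hF.
have K0 := volterra_cst_gt0 b0 b1.
set K := volterra_cst b in K0.
have L1 : 0 < L + 1 by rewrite ltr_wpDl.
have q0 : 0 < (2 * K * (L + 1))^-1.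
  by rewrite invr_gt0; apply: mulr_gt0 => //; exact: mulr_gt0.
have [k k0 Hk] := kernel_integral_expR_small b0 (ltW b1) q0.
exists k => // X Y C t cX cY C0 H i.
have [t0|t0] := leP t 0.
  by rewrite !volterra_map_le0// subrr normr0 mulr_ge0 ?expR_ge0// divr_ge0.
rewrite !mxE -/K opprD addrACA subrr add0r -mulrBr normrM (gtr0_norm K0).
have cE1 : continuous (fun s => expR (k * s)).
  move=> x; apply: continuous_comp; last exact: continuous_expR.
  by apply: cvgM; [exact: cvg_cst|exact: cvg_id].
have cE2 : continuous (fun s => L * C * expR (k * s)).
  by move=> x; apply: cvgM; [exact: cvg_cst|exact: cE1].
have := @kernel_integral_dist b (fun s => F (X s) 0 i) (fun s => F (Y s) 0 i)
  (fun s => L * C * expR (k * s)) t b0 (coordwise_lipschitz_comp L0 hF cX (i := i))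
  (coordwise_lipschitz_comp L0 hF cY (i := i)) cE2.
have HF s : 0 <= s <= t -> `|F (X s) 0 i - F (Y s) 0 i| <= L * C * expR (k * s).
  move=> st; rewrite -mulrA; apply: hF; last exact: H.
  by rewrite mulr_ge0 ?expR_ge0.
move=> /(_ HF); rewrite kernel_integralZ// => H1.
have H2 := Hk _ (ltW t0).
apply: (@le_trans _ _ (K * (L * C * ((2 * K * (L + 1))^-1 * expR (k * t))))).
  rewrite ler_pM2l//; apply: le_trans H1 _.
  by rewrite ler_wpM2l// mulr_ge0.
have -> : K * (L * C * ((2 * K * (L + 1))^-1 * expR (k * t))) =
    L / (L + 1) * (C / 2 * expR (k * t)).
  by field; rewrite !gt_eqF.
rewrite ler_piMl ?mulr_ge0 ?expR_ge0 ?invr_ge0//.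
by rewrite ler_pdivrMr// mul1r lerDl.
Qed.

Lemma le_geometric_le0 (x : R) A : (forall n, x <= A / 2 ^+ n) -> x <= 0.
Proof.
move=> H; apply/ler_addgt0Pr => e e0; rewrite add0r.
have A0 : 0 < `|A| + 1 by rewrite ltr_wpDl.
have [n Hn] : exists n : nat, (`|A| + 1) / e < 2 ^+ n.
  exists (Num.bound ((`|A| + 1) / e)).
  apply: lt_trans (archi_boundP _) _; first by rewrite divr_ge0 ?ltW.
  by rewrite -natrX ltr_nat ltn_expl.
apply: le_trans (H n) _.
rewrite ler_pdivrMr ?exprn_gt0//.
move: Hn; rewrite ltr_pdivrMr// mulrC => Hn.
by apply: le_trans (ltW Hn); rewrite (le_trans (ler_norm _))// lerDl.
Qed.

(** The sequences [v n - 2 A / 2 ^ n] and [v n + 2 A / 2 ^ n] are respectively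
    increasing and decreasing, and the limit is the supremum of the former. *)
Lemma geometric_limit (v : nat -> R) A : 0 <= A ->
  (forall n, `|v n.+1 - v n| <= A / 2 ^+ n) ->
  exists l, forall n, `|l - v n| <= 2 * A / 2 ^+ n.
Proof.
move=> A0 H.
pose B n := 2 * A / 2 ^+ n.
have BS n : B n = 2 * B n.+1 by rewrite /B exprS; field; rewrite expf_neq0.
have HB n : `|v n.+1 - v n| <= B n.+1.
  by rewrite /B exprS -mulf_div divff// mul1r; exact: H.
have lo m n : v n - B n <= v (n + m)%N - B (n + m)%N.
  elim: m => [|m IH]; first by rewrite addn0.
  apply: le_trans IH _; rewrite addnS.
  have := HB (n + m)%N; rewrite ler_norml => /andP[h1 _].
  have := BS (n + m)%N; lra.
have hi m n : v (n + m)%N + B (n + m)%N <= v n + B n.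
  elim: m => [|m IH]; first by rewrite addn0.
  apply: le_trans IH; rewrite addnS.
  have := HB (n + m)%N; rewrite ler_norml => /andP[_ h1].
  have := BS (n + m)%N; lra.
have B0 n : 0 <= B n by rewrite /B divr_ge0 ?mulr_ge0 ?exprn_ge0.
have lohi n m : v n - B n <= v m + B m.
  apply: le_trans (lo m n) _; apply: le_trans (hi n m).
  by rewrite addnC; have := B0 (m + n)%N; lra.
pose E := [set v n - B n | n in [set: nat]].
have ubE m : ubound E (v m + B m) by move=> _ [n _ <-].
have supE : has_sup E.
  by split; [exists (v 0%N - B 0%N), 0%N|exists (v 0%N + B 0%N)].
exists (sup E) => n; rewrite ler_distl -/(B n); apply/andP; split.
  by apply: ub_le_sup; [exact: supE.2|exists n].
by apply: ge_sup; [exact: supE.1|exact: ubE].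
Qed.

(** Picard iteration from the constant function. *)
Lemma volterra_solution_exists b F L x0 : 0 < b -> b < 1 -> 0 <= L ->
  coordwise_lipschitz F L ->
  exists X, coordwise_continuous X /\ forall t, X t = volterra_map b F x0 X t.
Proof.
move=> b0 b1 L0 hF.
have [k k0 Hk] := volterra_map_contraction x0 b0 b1 L0 hF.
pose P := volterra_map b F x0.
pose S n := iter n P (cst x0).
have cS n : coordwise_continuous (S n).
  elim: n => [|n IH] /=; first by move=> i t; exact: cst_continuous.
  exact: volterra_map_continuous L0 hF IH.
have Sle0 n t : t <= 0 -> S n t = x0.
  by case: n => // n t0; rewrite /S/= /P volterra_map_le0.
have first_step : exists2 A : R, 0 <= A & forall t i, 0 <= t -> `|S 1%N t 0 i - S 0%N t 0 i| <= A * expR (k * t).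
  have K0 := volterra_cst_gt0 b0 b1; set K := volterra_cst b in K0.
  (* The first step is K |F x0| t^b / b, and t^b <= 1 + t <= (1 + 1/k) exp (k t). *)
  pose c i := K * `|F x0 0 i| * (b^-1 * (1 + k^-1)).
  have c0 i : 0 <= c i.
    apply: mulr_ge0; first by apply: mulr_ge0 => //; exact: ltW.
    apply: mulr_ge0; first by rewrite invr_ge0 ltW.
    by rewrite addr_ge0// invr_ge0 ltW.
  exists (\sum_i c i); first by apply: sumr_ge0.
  move=> t i t0; rewrite /S/= /P mxE /= (addrC (x0 0 i)) addrK -/K.
  have -> : kernel_integral b (fun=> F x0 0 i) t = F x0 0 i * kernel_mass b t.
    exact: kernel_integral_cst.
  rewrite normrM (gtr0_norm K0) normrM (ger0_norm (kernel_mass_ge0 t b0)).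
  apply: (@le_trans _ _ (c i * expR (k * t))); last first.
    rewrite ler_wpM2r ?expR_ge0// (bigD1 i)//= lerDl.
    by apply: sumr_ge0.
  have -> : c i * expR (k * t) =
    K * (`|F x0 0 i| * (b^-1 * ((1 + k^-1) * expR (k * t)))) by rewrite /c; ring.
  apply: ler_wpM2l; first exact: ltW.
  apply: ler_wpM2l => //.
  rewrite /kernel_mass mulrC; apply: ler_wpM2l; first by rewrite invr_ge0 ltW.
  apply: (@le_trans _ _ (1 + t)).
    have [t1|t1] := leP t 1.
      rewrite (@le_trans _ _ 1)// ?lerDl// (@le_trans _ _ (1 `^ b))//; last first.
        by rewrite powR1.
      by rewrite ge0_ler_powR ?nnegrE ?(ltW b0).
    by apply: (@le_trans _ _ t); [rewrite ler1_powR// ltW|rewrite lerDr].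
  apply: (@le_trans _ _ ((1 + k^-1) * (1 + k * t))).
    have -> : (1 + k^-1) * (1 + k * t) = 1 + t + (k * t + k^-1).
      by field; rewrite gt_eqF.
    by rewrite lerDl addr_ge0 ?invr_ge0 ?mulr_ge0 ?(ltW k0).
  rewrite ler_wpM2l ?addr_ge0 ?invr_ge0 ?(ltW k0)//.
  by rewrite expR_ge1Dx.
have [A A0 HA] := first_step.
have step n t i : 0 <= t -> `|S n.+1 t 0 i - S n t 0 i| <= A / 2 ^+ n * expR (k * t).
  elim: n t i => [|n IH] t i t0; first by rewrite expr0 divr1; exact: HA.
  have -> : A / 2 ^+ n.+1 = A / 2 ^+ n / 2 by rewrite exprS invfM mulrA mulrAC.
  apply: (Hk (S n.+1) (S n)); [exact: cS|exact: cS| |].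
    by rewrite divr_ge0 ?exprn_ge0.
  by move=> s /andP[s0 _] j; exact: IH.
have lims t i : exists l, forall n, `|l - S n t 0 i| <= 2 * (A * expR (k * t)) / 2 ^+ n.
  have [t0|/ltW t0] := leP 0 t.
    apply: (@geometric_limit (fun n => S n t 0 i)) => [|n].
      by rewrite mulr_ge0 ?expR_ge0.
    by rewrite mulrAC; exact: step.
  exists (x0 0 i) => n; rewrite Sle0// subrr normr0.
  by rewrite divr_ge0 ?exprn_ge0// !mulr_ge0 ?expR_ge0.
pose X : R -> 'rV[R]_d := fun t => \row_i sval (cid (lims t i)).
have XS n t i : `|X t 0 i - S n t 0 i| <= 2 * (A * expR (k * t)) / 2 ^+ n.
  by rewrite mxE; exact: (svalP (cid (lims t i))).
have cX : coordwise_continuous X.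
  move=> i t; apply/cvgrPdist_le => /= e e0.
  pose A' := 2 * (A * expR (k * (t + 1))).
  have A'0 : 0 <= A' by rewrite !mulr_ge0 ?expR_ge0.
  have [n Hn] : exists n, A' / 2 ^+ n <= e / 3.
    apply: contrapT => /forallNP Hn.
    have : e / 3 <= 0.
      apply: (@le_geometric_le0 _ A') => n.
      by have /negP := Hn n; rewrite -ltNge => /ltW.
    by rewrite leNgt divr_gt0.
  have XSn s : s <= t + 1 -> `|X s 0 i - S n s 0 i| <= e / 3.
    move=> st; apply: le_trans (XS n s i) _; apply: le_trans Hn.
    rewrite /A' ler_wpM2r ?invr_ge0 ?exprn_ge0// ler_wpM2l// ler_wpM2l//.
    by rewrite ler_expR ler_pM2l.
  near=> s.
  have st1 : s <= t + 1.
    have : `|t - s| <= 1 by near: s; apply: cvgr_dist_le => //; exact: cvg_id.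
    by rewrite ler_distlC => /andP[].
  have h1 : `|X t 0 i - S n t 0 i| <= e / 3 by apply: XSn; rewrite lerDl.
  have h2 := XSn s st1.
  have h3 : `|S n t 0 i - S n s 0 i| <= e / 3.
    near: s; have /cvgrPdist_le := cS n i t; apply.
    by rewrite divr_gt0.
  have -> : X t 0 i - X s 0 i = (X t 0 i - S n t 0 i) + (S n t 0 i - S n s 0 i)
     + - (X s 0 i - S n s 0 i) by ring.
  apply: le_trans (ler_normD _ _) _; rewrite normrN.
  have := ler_normD (X t 0 i - S n t 0 i) (S n t 0 i - S n s 0 i).
  lra.
exists X; split=> // t; apply/rowP => i.
apply/eqP; rewrite -subr_eq0 -normr_eq0 eq_le normr_ge0 andbT.
apply: (@le_geometric_le0 _ (2 * (A * expR (k * t)))) => n.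
have h1 := XS n.+1 t i.
have h2 : `|S n.+1 t 0 i - P X t 0 i| <= 2 * A / 2 ^+ n / 2 * expR (k * t).
  apply: (Hk (S n) X); [exact: cS|exact: cX| |].
    by rewrite divr_ge0 ?exprn_ge0// mulr_ge0.
  move=> s _ j; rewrite distrC; apply: le_trans (XS n s j) _.
  by rewrite mulrA [leRHS]mulrAC.
have -> : X t 0 i - volterra_map b F x0 X t 0 i =
  (X t 0 i - S n.+1 t 0 i) + (S n.+1 t 0 i - P X t 0 i) by rewrite addrA subrK.
apply: le_trans (ler_normD _ _) _.
apply: le_trans (lerD h1 h2) _.
have -> : 2 * (A * expR (k * t)) / 2 ^+ n.+1 = (A * expR (k * t)) / 2 ^+ n.
  by rewrite exprS; field; rewrite expf_neq0.
have -> : 2 * A / 2 ^+ n / 2 * expR (k * t) = (A * expR (k * t)) / 2 ^+ n.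
  by field; rewrite expf_neq0.
rewrite le_eqVlt; apply/orP; left; apply/eqP; field.
by rewrite expf_neq0.
Unshelve. all: by end_near. Qed.

Lemma volterra_solution_unique b F L x0 X Y T : 0 < b -> b < 1 -> 0 <= L ->
  coordwise_lipschitz F L -> coordwise_continuous X -> coordwise_continuous Y ->
  (forall t, 0 <= t < T -> X t = volterra_map b F x0 X t) ->
  (forall t, 0 <= t < T -> Y t = volterra_map b F x0 Y t) ->
  forall t, 0 <= t < T -> X t = Y t.
Proof.
move=> b0 b1 L0 hF cX cY HX HY.
have [k k0 Hk] := volterra_map_contraction x0 b0 b1 L0 hF.
have bnd : exists2 C : R, 0 <= C & forall s i, 0 <= s < T -> `|X s 0 i - Y s 0 i| <= C.
  have H i : exists M, 0 <= M /\ forall s, 0 <= s <= T -> `|X s 0 i - Y s 0 i| <= M.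
    apply: continuous_bounded => s.
    by apply: cvgB; [exact: cX|exact: cY].
  exists (\sum_i sval (cid (H i))).
    by apply: sumr_ge0 => i _; case: cid => /= M [].
  move=> s i /andP[s0 sT]; rewrite (bigD1 i)//=.
  apply: (@le_trans _ _ (sval (cid (H i)))).
    by case: cid => /= M [_]; apply; rewrite s0 ltW.
  by rewrite lerDl sumr_ge0// => j _; case: cid => /= M [].
have [C C0 HC] := bnd.
have step n t i : 0 <= t < T -> `|X t 0 i - Y t 0 i| <= C / 2 ^+ n * expR (k * t).
  elim: n t i => [|n IH] t i tT.
    rewrite expr0 divr1; apply: le_trans (HC _ _ tT) _.
    have /andP[t0 _] := tT.
    by rewrite ler_peMr// -expR0 ler_expR mulr_ge0// ltW.
  have -> : C / 2 ^+ n.+1 = C / 2 ^+ n / 2 by rewrite exprS invfM mulrA mulrAC.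
  rewrite HX// HY//; apply: Hk => //; first by rewrite divr_ge0 ?exprn_ge0.
  move=> s /andP[s0 st] j; apply: IH; rewrite s0 (le_lt_trans st)//.
  by case/andP: tT.
move=> t tT; apply/rowP => i.
apply/eqP; rewrite -subr_eq0 -normr_eq0 eq_le normr_ge0 andbT.
apply: (@le_geometric_le0 _ (C * expR (k * t))) => n.
by rewrite mulrAC; exact: step.
Qed.

End volterra_equation.

(** * The fractional Lyapunov inequality *)

Section euclidean.
Context {R : realType} (d : nat).
Implicit Types (u v x y : 'rV[R]_d) (X Y G : R -> 'rV[R]_d) (V : 'rV[R]_d -> R).

Lemma enorm_ge0 u : 0 <= enorm u.
Proof. exact: sqrtr_ge0. Qed.

Lemma enorm0 : enorm (0 : 'rV[R]_d) = 0.
Proof.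
rewrite /enorm /dotv big1 ?sqrtr0// => i _; by rewrite mxE mul0r.
Qed.

Lemma enorm_coord u i : `|u 0 i| <= enorm u.
Proof.
rewrite /enorm -sqrtr_sqr ler_sqrt; last first.
  by apply: sumr_ge0 => j _; rewrite -expr2 sqr_ge0.
rewrite /dotv (bigD1 i)//= expr2 lerDl.
by apply: sumr_ge0 => j _; rewrite -expr2 sqr_ge0.
Qed.

Lemma enorm_le_coord u (B : R) : 0 <= B -> (forall i, `|u 0 i| <= B) ->
  enorm u <= d%:R * B.
Proof.
move=> B0 uB; rewrite -(@ger0_norm _ (d%:R * B)) ?mulr_ge0// -sqrtr_sqr.
rewrite /enorm ler_sqrt ?sqr_ge0//.
apply: (@le_trans _ _ (\sum_(i < d) B ^+ 2)).
  apply: ler_sum => i _; rewrite -expr2 -real_normK ?num_real//.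
  by rewrite lerXn2r ?nnegrE.
rewrite sumr_const card_ord -[X in X <= _]mulr_natl exprMn ler_wpM2r ?sqr_ge0//.
by rewrite -natrX ler_nat; case: (d) => // n; rewrite leq_pmulr.
Qed.

Lemma continuous_bigsum (I : Type) (r : seq I) (f : I -> R -> R) :
  (forall i, continuous (f i)) -> continuous (fun s => \sum_(i <- r) f i s).
Proof.
move=> cf; elim: r => [|i r IH].
  have -> : (fun s => \sum_(i <- [::]) f i s) = cst 0.
    by apply/funext => s; rewrite big_nil.
  by move=> x; exact: cst_continuous.
have -> : (fun s => \sum_(j <- i :: r) f j s) = (fun s => f i s + \sum_(j <- r) f j s).
  by apply/funext => s; rewrite big_cons.
by move=> x; apply: cvgD; [exact: cf|exact: IH].
Qed.

Lemma kernel_integral_sum (I : Type) (r : seq I) (f : I -> R -> R) b t : 0 < b ->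
  (forall i, continuous (f i)) ->
  kernel_integral b (fun s => \sum_(i <- r) f i s) t =
  \sum_(i <- r) kernel_integral b (f i) t.
Proof.
move=> b0 cf; elim: r => [|i r IH].
  rewrite big_nil (@eq_kernel_integral _ _ _ (cst 0)).
    have [t0|/ltW t0] := leP 0 t; first by rewrite kernel_integral_cst// mul0r.
    by rewrite kernel_integral_le0.
  by move=> s _; rewrite big_nil.
rewrite big_cons -IH -kernel_integralD//; last exact: continuous_bigsum.
by apply: eq_kernel_integral => s _; rewrite big_cons.
Qed.

Lemma continuous_enorm X : coordwise_continuous X -> continuous (fun t => enorm (X t)).
Proof.
move=> cX t; apply: (@continuous_comp _ _ _ (fun t => dotv (X t) (X t)) Num.sqrt).
  apply: (@continuous_bigsum _ _ (fun i s => X s 0 i * X s 0 i)) => i s.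
  by apply: cvgM; exact: cX.
exact: sqrt_continuous.
Qed.

Lemma continuous_coord X : coordwise_continuous X -> continuous X.
Proof.
move=> cX t; apply/cvg_ballP => e e0.
have H : \forall s \near t, forall j, `|X t 0 j - X s 0 j| < e.
  apply: (@filter_forall R 'I_d (fun j s => `|X t 0 j - X s 0 j| < e)
    (nbhs t) (nbhs_filter t)) => j.
  by have /cvgrPdist_lt := cX j t; apply.
near=> s; have Hs : forall j, `|X t 0 j - X s 0 j| < e by near: s.
by split => // i j; rewrite ord1; exact: Hs.
Unshelve. all: by end_near. Qed.

Lemma dotv_gradient V x u : differentiable V x ->
  dotv (gradient V x) u = 'D_u V x.
Proof.
move=> dV; rewrite deriveE// {2}(row_sum_delta u) linear_sum.
apply: eq_bigr => i _; rewrite mxE linearZ/= deriveE// mulrC//.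
Qed.

(** Convexity bounds the difference quotients along [y - x] by the increment. *)
Lemma tangent_le V x y : convex_function setT V -> differentiable V x ->
  dotv (gradient V x) (y - x) <= V y - V x.
Proof.
move=> cV dV; rewrite dotv_gradient//.
have dd : derivable V x (y - x) by exact: diff_derivable.
have H : (fun h : R => h^-1 *: (V (h *: (y - x) + x) - V x)) h @[h --> 0^'+]
    --> 'D_(y - x) V x.
  by apply: cvg_dnbhs_at_right; exact: dd.
rewrite -(cvg_lim _ H)//; apply: limr_le; first by apply/cvg_ex; eexists; exact: H.
near=> h.
have h0 : 0 < h by near: h; exact: nbhs_right_gt.
have h1 : h <= 1 by near: h; exact: nbhs_right_le.
have := cV (Itv01 (ltW h0) h1) y x.
rewrite !inE => /(_ I I).
move=> Hc; have {}Hc : V (h *: y + (1 - h) *: x) <= h * V y + (1 - h) * V x := Hc.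
have E : h *: y + (1 - h) *: x = h *: (y - x) + x.
  by rewrite scalerBl scale1r scalerBr addrA addrAC.
rewrite E in Hc; rewrite /GRing.scale/=.
rewrite mulrC ler_pdivrMr//; move: Hc.
set z := V (_ + x); lra.
Unshelve. all: by end_near. Qed.

Lemma dotvDr u v w : dotv u (v + w) = dotv u v + dotv u w.
Proof. by rewrite /dotv -big_split; apply: eq_bigr => i _; rewrite mxE mulrDr. Qed.

Lemma dotvNr u v : dotv u (- v) = - dotv u v.
Proof. by rewrite /dotv -sumrN; apply: eq_bigr => i _; rewrite mxE mulrN. Qed.

(** The maximum principle for [<p, X s - x0> + lam * s ^ alpha], where [p] is the
    gradient at [X t].  The term [lam * s ^ alpha] is the fractional integral of a
    constant, so that this function is a fractional integral too. *)
Lemma lyapunov_barrier alpha V X G x0 t lam : 0 < alpha -> alpha < 1 ->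
  convex_function setT V -> differentiable V (X t) ->
  coordwise_continuous G -> 0 < t -> 
  (forall s, 0 <= s <= t -> forall i,
    X s 0 i = x0 0 i + volterra_cst alpha * kernel_integral alpha (fun s => G s 0 i) s) ->
  (forall s, 0 <= s <= t -> V (X s) - V (X t) <= lam * (t `^ alpha - s `^ alpha)) ->
  (V (X t) - V x0 + lam * t `^ alpha) * t `^ (- alpha) <=
  volterra_cst alpha * beta_cst alpha *
  (dotv (gradient V (X t)) (G t) + lam * alpha / volterra_cst alpha).
Proof.
move=> a0 a1 cV dV cG t0 HX Hlam.
have K0 := volterra_cst_gt0 a0 a1; set K := volterra_cst alpha in HX K0 *.
set p := gradient V (X t).
have cp : continuous (fun s => dotv p (G s)).
  apply: (@continuous_bigsum _ _ (fun i s => p 0 i * G s 0 i)) => i s.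
  by apply: cvgM; [exact: cvg_cst|exact: cG].
pose g s := dotv p (G s) + lam * alpha / K.
have cc : continuous (cst (lam * alpha / K) : R -> R) by move=> x; exact: cst_continuous.
have cg : continuous g.
  by move=> x; apply: cvgD; [exact: cp|exact: cvg_cst].
have gE s : 0 <= s <= t ->
    K * kernel_integral alpha g s = dotv p (X s - x0) + lam * s `^ alpha.
  move=> st; have /andP[s0 _] := st.
  rewrite (@kernel_integralD _ _ (fun s => dotv p (G s)) (cst (lam * alpha / K)))//.
  rewrite kernel_integral_cst// mulrDr; congr (_ + _); last first.
    by rewrite /kernel_mass; field; rewrite !gt_eqF.
  rewrite (@kernel_integral_sum _ _ (fun i s => p 0 i * G s 0 i))//; last first.
    by move=> i x; apply: cvgM; [exact: cvg_cst|exact: cG].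
  rewrite mulr_sumr; apply: eq_bigr => i _.
  rewrite kernel_integralZ// !mxE HX// mulrCA; congr (_ * _).
  by rewrite (addrC (x0 0 i)) addrK.
have tt : 0 <= t <= t by rewrite lexx ltW.
have gmax s : 0 <= s <= t -> kernel_integral alpha g s <= kernel_integral alpha g t.
  move=> st; rewrite -(ler_pM2l K0) !gE//.
  have := tangent_le (X s) cV dV; rewrite -/p => Ht.
  have Hl := Hlam _ st.
  have -> : dotv p (X s - x0) = dotv p (X t - x0) + dotv p (X s - X t).
    by rewrite -dotvDr; congr dotv; rewrite [RHS]addrC addrA subrK.
  by move: Hl; rewrite mulrBr; lra.
have := kernel_integral_max_principle a0 a1 cg t0 gmax.
rewrite -(ler_pM2l K0) mulrA gE// mulrA; apply: le_trans.
rewrite ler_wpM2r ?powR_ge0// lerD2r.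
have := tangent_le x0 cV dV; rewrite -/p -opprB dotvNr; lra.
Qed.

End euclidean.

Section first_exit.
Context {R : realType}.
Implicit Types (s t e : R).

(** The exit time is the infimum of the closed set of times where [phi >= e]. *)
Lemma first_exit (phi : R -> R) e t2 : continuous phi -> phi 0 < e -> 0 <= t2 ->
  e <= phi t2 ->
  exists t1, [/\ 0 < t1, t1 <= t2, phi t1 = e & forall s, 0 <= s <= t1 -> phi s <= e].
Proof.
move=> cphi phi0 t20 phit2.
pose A := [set s | 0 <= s /\ e <= phi s].
have At2 : A t2 by [].
have infA : has_inf A by split; [exists t2|exists 0 => s []].
pose t1 := inf A.
have t1_ge0 : 0 <= t1 by apply: lb_le_inf; [exists t2|move=> s []].
have t1t2 : t1 <= t2 by apply: ge_inf => //; exact: infA.2.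
have below s : 0 <= s -> s < t1 -> phi s < e.
  move=> s0 st; rewrite ltNge; apply/negP => es.
  by have := ge_inf infA.2 (conj s0 es : A s); rewrite leNgt st.
have ge : e <= phi t1.
  rewrite leNgt; apply/negP => lt.
  have /cvgrPdist_lt /(_ (e - phi t1)) := cphi t1.
  rewrite subr_gt0 => /(_ lt) [dl /= dl0 Hd].
  have [s As] := inf_adherent dl0 infA.
  rewrite -/t1 => st.
  have ts : t1 <= s by apply: ge_inf => //; exact: infA.2.
  have /Hd/= : ball_ [eta Num.Def.normr] t1 dl s.
    by rewrite /ball_/= distrC ger0_norm ?subr_ge0// ltrBlDl.
  have [_ es] := As.
  rewrite distrC => /(le_lt_trans (ler_norm _)); lra.
have t1_gt0 : 0 < t1.
  rewrite lt_neqAle t1_ge0 andbT; apply/eqP => t10.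
  by move: ge; rewrite -t10 leNgt phi0.
have le : phi t1 <= e.
  rewrite leNgt; apply/negP => gt.
  have /cvgrPdist_lt /(_ (phi t1 - e)) := cphi t1.
  rewrite subr_gt0 => /(_ gt) [dl /= dl0 Hd].
  pose s := t1 - Num.min (dl / 2) t1.
  have m0 : 0 < Num.min (dl / 2) t1 by rewrite lt_min t1_gt0 divr_gt0.
  have st : s < t1 by rewrite ltrBlDr ltrDl.
  have s0 : 0 <= s by rewrite subr_ge0 ge_min lexx orbT.
  have /Hd/= : ball_ [eta Num.Def.normr] t1 dl s.
    rewrite /ball_/= /s subKr gtr0_norm// gt_min.
    by apply/orP; left; rewrite ltr_pdivrMr// ltr_pMr// ltr1n.
  move=> /(le_lt_trans (ler_norm _)).
  have := below _ s0 st; lra.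
have eq : phi t1 = e by apply/eqP; rewrite eq_le le ge.
exists t1; split => // s /andP[s0]; rewrite le_eqVlt => /predU1P[->//|st].
by rewrite ltW// below.
Qed.

End first_exit.

(** * Lyapunov estimates along solutions *)

Lemma powR_div (R : realType) (x y r : R) : 0 <= x -> 0 < y ->
  (x / y) `^ r = x `^ r / y `^ r.
Proof.
move=> x0 y0; rewrite powRM ?invr_ge0 ?(ltW y0)//; congr (_ * _).
by rewrite -powR_inv1 ?(ltW y0)// -powRrM mulN1r powRN.
Qed.

Section lyapunov.
Context {R : realType} (d : nat).
Implicit Types (X Y G : R -> 'rV[R]_d).
Context (alpha : R) (V : 'rV[R]_d -> R) (a b C1 C2 : R).
Context (alpha_gt0 : 0 < alpha) (alpha_lt1 : alpha < 1).
Context (V_convex : convex_function setT V) (V_diff : forall x, differentiable V x).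

Definition solves_volterra X G :=
  [/\ coordwise_continuous X, coordwise_continuous G &
      forall t i, 0 <= t -> X t 0 i = X 0 0 i +
        volterra_cst alpha * kernel_integral alpha (fun s => G s 0 i) t].

Lemma continuous_V X : coordwise_continuous X -> continuous (V \o X).
Proof.
move=> cX t; apply: continuous_comp; first exact: continuous_coord.
exact: differentiable_continuous.
Qed.

(** At a positive maximum time with value above the initial one, the barrier
    inequality with [lam = 0] would make [<grad V, G>] positive. *)
Lemma V_le_initial X G T : solves_volterra X G ->
  (forall s, 0 <= s <= T -> dotv (gradient V (X s)) (G s) <= 0) ->
  forall s, 0 <= s <= T -> V (X s) <= V (X 0).
Proof.
move=> [cX cG HX] Hneg s /andP[s0 sT].
have T0 := le_trans s0 sT.
have cVX : {within `[0, T], continuous (V \o X)}.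
  exact/continuous_subspaceT/continuous_V.
have [t] := EVT_max T0 cVX; rewrite in_itv/= => /andP[].
rewrite le_eqVlt => /predU1P[<- _|t0 tT] tmax.
  by apply: tmax; rewrite in_itv/= s0.
apply: le_trans (tmax s _) _; first by rewrite in_itv/= s0.
rewrite leNgt; apply/negP => gt0V.
have HX' r : 0 <= r <= t -> forall i, X r 0 i = X 0 0 i +
    volterra_cst alpha * kernel_integral alpha (fun s => G s 0 i) r.
  by move=> /andP[r0 _] i; exact: HX.
have tmax' r : 0 <= r <= t -> V (X r) - V (X t) <= 0 * (t `^ alpha - r `^ alpha).
  move=> /andP[r0 rt]; rewrite mul0r subr_le0; apply: tmax.
  by rewrite in_itv/= r0 (le_trans rt).
have := lyapunov_barrier alpha_gt0 alpha_lt1 V_convex (V_diff (X t)) cG t0 HX' tmax'.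
rewrite !mul0r !addr0; apply/negP; rewrite -ltNge.
apply: (@le_lt_trans _ _ 0).
  rewrite mulr_ge0_le0//; last by rewrite Hneg// (ltW t0).
  by rewrite mulr_ge0 ?ltW// ?volterra_cst_gt0 ?beta_cst_gt0.
by rewrite mulr_gt0 ?powR_gt0// subr_gt0.
Qed.

Lemma V_stays_in_ball X G e : solves_volterra X G ->
  (forall x, enorm x <= e -> C1 * enorm x `^ a <= V x <= C2 * enorm x `^ b) ->
  (forall s, 0 <= s -> enorm (X s) <= e -> dotv (gradient V (X s)) (G s) <= 0) ->
  enorm (X 0) < e -> C2 * enorm (X 0) `^ b < C1 * e `^ a ->
  forall t, 0 <= t -> enorm (X t) < e.
Proof.
move=> sX Vb Hneg X0e X0V t t0.
have [cX cG HX] := sX.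
rewrite ltNge; apply/negP => et.
have [t1 [t10 t1t et1 t1e]] := first_exit (continuous_enorm cX) X0e t0 et.
have Hn s : 0 <= s <= t1 -> dotv (gradient V (X s)) (G s) <= 0.
  by move=> /[dup] /andP[s0 _] /t1e; exact: Hneg.
have := V_le_initial sX Hn (s := t1); rewrite lexx (ltW t10) => /(_ isT).
apply/negP; rewrite -ltNge.
have /andP[_ h1] := Vb _ (ltW X0e).
have /andP[h2 _] : C1 * enorm (X t1) `^ a <= V (X t1) <= C2 * enorm (X t1) `^ b.
  by apply: Vb; rewrite et1.
apply: le_lt_trans h1 _; apply: lt_le_trans X0V _.
by rewrite -et1.
Qed.

(** The bound is obtained at a maximum point [t] of [t ^ beta * V (X t)], where
    [V (X r) <= (t / r) ^ beta * V (X t)] for [r <= t], and [V (X r) <= W].  As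
    [beta <= alpha], this yields the hypothesis of lyapunov_barrier with [lam] a multiple of
    [W * t ^ (- alpha)]. *)
Lemma V_algebraic_decay X G e c C3 W :
  (forall x, 0 <= V x) -> solves_volterra X G ->
  0 < b -> 0 < c -> 0 < C2 -> 0 < C3 -> 0 < W ->
  (forall x, enorm x <= e -> C1 * enorm x `^ a <= V x <= C2 * enorm x `^ b) ->
  (forall s, 0 <= s -> enorm (X s) <= e) ->
  (forall s, 0 <= s -> dotv (gradient V (X s)) (G s) <= - C3 * enorm (X s) `^ c) ->
  V (X 0) <= W ->
  forall t, 0 <= t ->
    t `^ (Num.min (alpha * (b / c)) alpha) * V (X t) <=
    W + C2 * (W * (2 `^ alpha + (1 - 2 `^ (- alpha))^-1) * alpha
              / volterra_cst alpha / C3) `^ (b / c).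
Proof.
move=> V0 sX b0 c0 C20 C30 W0 Vb Xe Hdec VW T T0.
have K0 := volterra_cst_gt0 alpha_gt0 alpha_lt1.
have B0 := beta_cst_gt0 alpha_gt0 alpha_lt1.
have [cX cG HX] := sX.
set beta := Num.min _ _.
have beta0 : 0 < beta by rewrite lt_min alpha_gt0 andbT mulr_gt0// divr_gt0.
have beta_le : beta <= alpha by rewrite ge_min lexx orbT.
have beta_le' : beta <= alpha * (b / c) by rewrite ge_min lexx.
set K1 := 2 `^ alpha + _.
have p2 : 2 `^ (- alpha) < (1 : R).
  rewrite powRN invf_lt1 ?powR_gt0//.
  apply: (@le_lt_trans _ _ (1 `^ alpha)); first by rewrite powR1.
  by rewrite gt0_ltr_powR ?nnegrE// ltr1n.
have i2 : 0 < (1 - 2 `^ (- alpha))^-1 :> R by rewrite invr_gt0 subr_gt0.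
have K1_gt0 : 0 < K1 by rewrite addr_gt0// powR_gt0.
have K1_ge1 : 1 <= K1.
  rewrite /K1 -[leLHS]addr0 lerD ?(ltW i2)//.
  by rewrite -[leLHS](powRr0 2) ler_powR ?ler1n// ltW.
have VleW s : 0 <= s -> V (X s) <= W.
  move=> s0; apply: le_trans VW; apply: (V_le_initial sX (T := s)); last by rewrite s0 lexx.
  move=> r /andP[r0 _]; apply: le_trans (Hdec _ r0) _.
  by rewrite mulNr oppr_le0 mulr_ge0 ?powR_ge0// ltW.
set Q := W * K1 * alpha / volterra_cst alpha / C3.
have Q0 : 0 < Q by rewrite /Q; apply: divr_gt0 => //; apply: divr_gt0 => //; rewrite !mulr_gt0.
have beta1 : beta <= 1 by rewrite (le_trans beta_le)// ltW.
(* t `^ beta * V (X t), made continuous on the whole line. *)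
pose w t := beta * kernel_integral beta (cst 1) t * V (X t).
have wE t : 0 <= t -> w t = t `^ beta * V (X t).
  move=> t0; rewrite /w kernel_integral_cst// mul1r /kernel_mass.
  by rewrite mulrCA divff ?mulr1// gt_eqF.
have cw : {within `[0, T], continuous w}.
  apply: continuous_subspaceT => t; apply: cvgM; last exact: continuous_V.
  apply: cvgM; first exact: cvg_cst.
  by apply: continuous_kernel_integral => // x; exact: cst_continuous.
rewrite -wE//.
have [t] := EVT_max T0 cw; rewrite in_itv/= => /andP[].
rewrite le_eqVlt => /predU1P[<- _|t0 tT] tmax.
  apply: le_trans (tmax T _) _; first by rewrite in_itv/= T0 lexx.
  by rewrite wE// powR0 ?gt_eqF// mul0r addr_ge0 ?mulr_ge0 ?powR_ge0 ?ltW.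
apply: le_trans (tmax T _) _; first by rewrite in_itv/= T0 lexx.
rewrite wE ?(ltW t0)//.
have HX' r : 0 <= r <= t -> forall i, X r 0 i = X 0 0 i +
    volterra_cst alpha * kernel_integral alpha (fun s => G s 0 i) r.
  by move=> /andP[r0 _] i; exact: HX.
have ta : 0 < t `^ alpha by rewrite powR_gt0.
pose lam := W * K1 / t `^ alpha.
have lam0 : 0 < lam by rewrite divr_gt0// mulr_gt0.
have Hlam r : 0 <= r <= t -> V (X r) - V (X t) <= lam * (t `^ alpha - r `^ alpha).
  move=> /andP[r0 rt].
  have dr0 : 0 <= t `^ alpha - r `^ alpha.
    by rewrite subr_ge0 ge0_ler_powR ?nnegrE ?(ltW alpha_gt0) ?(ltW t0).
  have [r2|r2] := leP r (t / 2).
    (* For r <= t / 2 the right-hand side already exceeds W. *)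
    apply: (@le_trans _ _ W); first by rewrite lerBlDr ler_wpDr// VleW.
    have h : r `^ alpha <= t `^ alpha * 2 `^ (- alpha).
      apply: (@le_trans _ _ ((t / 2) `^ alpha)).
        by rewrite ge0_ler_powR ?nnegrE ?(ltW alpha_gt0)// divr_ge0// ltW.
      by rewrite powR_div ?(ltW t0)// powRN.
    apply: (@le_trans _ _ (lam * (t `^ alpha * (1 - 2 `^ (- alpha))))); last first.
      by rewrite ler_pM2l// mulrBr mulr1 lerB.
    rewrite /lam mulrA divfK ?gt_eqF// -mulrA ler_peMr ?(ltW W0)//.
    apply: (@le_trans _ _ ((1 - 2 `^ (- alpha))^-1 * (1 - 2 `^ (- alpha)))).
      by rewrite mulVf ?gt_eqF// subr_gt0.
    by rewrite ler_pM2r ?subr_gt0// /K1 lerDr powR_ge0.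
  have r_gt0 : 0 < r by apply: lt_trans r2; rewrite divr_gt0.
  have rb : 0 < r `^ beta by rewrite powR_gt0.
  have := tmax r; rewrite in_itv/= r0 (le_trans rt tT) !wE ?(ltW t0)// => /(_ isT) Hr.
  (* For r > t / 2, maximality at t bounds V (X r) by (t / r) ^ beta * V (X t). *)
  have Hq : (t / r) `^ beta <= (t / r) `^ alpha.
    by rewrite ler_powR// ler_pdivlMr// mul1r.
  have qE x : (t / r) `^ x = t `^ x / r `^ x.
    by rewrite powR_div// ltW.
  have ra : 0 < r `^ alpha by rewrite powR_gt0.
  have Vr : V (X r) <= t `^ alpha / r `^ alpha * V (X t).
    apply: (@le_trans _ _ (t `^ beta / r `^ beta * V (X t))).
      by rewrite mulrAC ler_pdivlMr// mulrC.
    by rewrite ler_wpM2r// -!qE.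
  apply: (@le_trans _ _ (V (X t) * (t `^ alpha - r `^ alpha) / r `^ alpha)).
    have -> : V (X t) * (t `^ alpha - r `^ alpha) / r `^ alpha =
      t `^ alpha / r `^ alpha * V (X t) - V (X t) by field; rewrite gt_eqF.
    by rewrite lerD2r.
  rewrite mulrAC ler_wpM2r//.
  apply: (@le_trans _ _ (W * (2 `^ alpha / t `^ alpha))).
    apply: ler_pM => //; rewrite ?invr_ge0 ?(ltW ra) ?VleW ?(ltW t0)//.
    rewrite -[leRHS]invrK lef_pV2 ?posrE ?invr_gt0 ?divr_gt0 ?powR_gt0//.
    rewrite invf_div.
    have -> : t `^ alpha / 2 `^ alpha = (t / 2) `^ alpha.
      by rewrite powR_div// ltW.
    by rewrite ge0_ler_powR ?nnegrE ?(ltW alpha_gt0) ?divr_ge0 ?(ltW t0) ?(ltW r2).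
  rewrite /lam mulrA ler_wpM2r ?invr_ge0 ?(ltW ta)// ler_pM2l// /K1.
  by rewrite lerDl ltW.
have := lyapunov_barrier alpha_gt0 alpha_lt1 V_convex (V_diff (X t)) cG t0 HX' Hlam.
have lhs0 : 0 <= (V (X t) - V (X 0) + lam * t `^ alpha) * t `^ (- alpha).
  rewrite mulr_ge0 ?powR_ge0// /lam divfK ?gt_eqF//.
  have : W <= W * K1 by rewrite ler_peMr// ltW.
  have := V0 (X t); lra.
move=> /(le_trans lhs0); rewrite (pmulr_rge0 _ (mulr_gt0 K0 B0)) => H1.
have := Hdec _ (ltW t0) => H2.
have H3 : t `^ alpha * enorm (X t) `^ c <= Q.
  rewrite mulrC -ler_pdivlMr// /Q.
  rewrite -(ler_pM2l C30).
  have -> : C3 * (W * K1 * alpha / volterra_cst alpha / C3 / t `^ alpha) =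
    lam * alpha / volterra_cst alpha by rewrite /lam; field; rewrite !gt_eqF.
  move: H1 H2; rewrite mulNr.
  set z := dotv _ _; lra.
have [t1|t1] := leP t 1.
  apply: (@le_trans _ _ W); last by rewrite lerDl mulr_ge0 ?powR_ge0// ltW.
  rewrite -[leRHS]mul1r ler_pM ?powR_ge0 ?VleW ?(ltW t0)//.
  apply: (@le_trans _ _ (1 `^ beta)); last by rewrite powR1.
  by rewrite ge0_ler_powR ?nnegrE ?(ltW t0) ?(ltW beta0).
apply: (@le_trans _ _ (C2 * Q `^ (b / c))); last by rewrite lerDr ltW.
have /andP[_ hV] := Vb _ (Xe _ (ltW t0)).
apply: (@le_trans _ _ (t `^ (alpha * (b / c)) * (C2 * enorm (X t) `^ b))).
  by rewrite ler_pM ?powR_ge0// ler_powR// ltW.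
rewrite mulrCA ler_pM2l//.
have -> : t `^ (alpha * (b / c)) * enorm (X t) `^ b =
    (t `^ alpha * enorm (X t) `^ c) `^ (b / c).
  rewrite powRM ?powR_ge0// -!powRrM; congr (_ * _ `^ _).
  by rewrite mulrC divfK// gt_eqF.
apply: ge0_ler_powR => //; rewrite ?nnegrE.
- by rewrite divr_ge0// ltW.
- by rewrite mulr_ge0 ?powR_ge0.
- exact: ltW.
Qed.

End lyapunov.

(** * Truncation and maximal solutions *)

Section truncation.
Context {R : realType} (d : nat).
Implicit Types (u v x y : 'rV[R]_d).

Definition clamp (l h s : R) : R := Num.max l (Num.min s h).

Lemma clamp_id l h s : l <= s <= h -> clamp l h s = s.
Proof. by move=> /andP[ls sh]; rewrite /clamp (min_idPl sh) (max_idPr ls). Qed.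

Lemma clamp_itv l h s : l <= h -> l <= clamp l h s <= h.
Proof. by move=> lh; rewrite /clamp le_max lexx/= ge_max lh ge_min lexx orbT. Qed.

Lemma clamp_lipschitz l h s t : `|clamp l h s - clamp l h t| <= `|s - t|.
Proof.
wlog st : s t / s <= t.
  move=> H; have [/H//|/ltW /H] := leP s t.
  by rewrite distrC (distrC t).
have mono : clamp l h s <= clamp l h t.
  by rewrite /clamp ge_max le_max lexx/= le_max; apply/orP; right;
    rewrite le_min !ge_min st lexx orbT.
rewrite distrC (distrC s) !ger0_norm ?subr_ge0//.
rewrite /clamp; case: (ltP s h) => ?; case: (ltP t h) => ?;
  case: (ltP l s) => ?; case: (ltP l t) => ?; case: (ltP l h) => ?; lra.
Qed.

Lemma continuous_clamp l h : continuous (clamp l h).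
Proof.
move=> s; apply/cvgrPdist_le => e e0; near=> t.
apply: le_trans (clamp_lipschitz _ _ _ _) _.
by near: t; apply: cvgr_dist_le => //; exact: cvg_id.
Unshelve. all: by end_near. Qed.

Definition clampv (h : R) (u : 'rV[R]_d) : 'rV[R]_d := \row_i clamp (- h) h (u 0 i).

Lemma clampv_id h u : enorm u <= h -> clampv h u = u.
Proof.
move=> uh; apply/rowP => i; rewrite mxE clamp_id// -ler_norml.
exact: le_trans (enorm_coord u i) uh.
Qed.

(** Clamping coordinates is 1-Lipschitz for the sup norm and maps into a cube
    contained in the neighborhood where [f] is Lipschitz. *)
Lemma lipschitz_truncation (D : set 'rV[R]_d) (f : 'rV[R]_d -> 'rV[R]_d) :
  lipschitz_near0 D f ->
  exists h L, [/\ 0 < h, 0 <= L & coordwise_lipschitz (f \o clampv h) L].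
Proof.
move=> [U [L [U0 UD fL]]].
have [e e0 eU] : exists2 e : R, 0 < e & ball (0 : 'rV[R]_d) e `<=` U.
  by move/nbhs_ballP : U0 => [e /= e0 eU]; exists e.
pose h := e / 2.
have h0 : 0 < h by rewrite divr_gt0.
have he : h < e by rewrite ltr_pdivrMr// ltr_pMr// ltr1n.
have clU u : U (clampv h u).
  apply: eU; split => // i j; rewrite ord1 /ball/= !mxE sub0r normrN.
  apply: le_lt_trans he; rewrite ler_norml clamp_itv//.
  by rewrite (@le_trans _ _ 0)// ?oppr_le0 ltW.
exists h, (`|L| * d%:R); split => // u v B B0 uvB i.
have -> : (f \o clampv h) u 0 i - (f \o clampv h) v 0 i = (f (clampv h u) - f (clampv h v)) 0 i.
  by rewrite !mxE.
apply: le_trans (enorm_coord _ _) _.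
apply: le_trans (fL _ _ (clU u) (clU v)) _.
apply: (@le_trans _ _ (`|L| * enorm (clampv h u - clampv h v))).
  by rewrite ler_wpM2r ?enorm_ge0// ler_norm.
rewrite -mulrA ler_wpM2l//; apply: enorm_le_coord => // j.
rewrite !mxE; apply: le_trans (clamp_lipschitz _ _ _ _) _.
exact: uvB.
Qed.

End truncation.

Section maximal_solutions.
Context {R : realType} (d : nat).
Implicit Types (X : R -> 'rV[R]_d) (x : 'rV[R]_d).
Context (alpha : R) (D : set 'rV[R]_d) (f : 'rV[R]_d -> 'rV[R]_d) (h L rho : R).
Context (alpha_gt0 : 0 < alpha) (alpha_lt1 : alpha < 1).
Context (L_ge0 : 0 <= L) (f_trunc : coordwise_lipschitz (f \o clampv h) L).
Context (rho_h : rho <= h) (rho_D : eball rho `<=` D).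
Let F := f \o @clampv R d h.

Lemma trunc_id u : enorm u <= rho -> F u = f u.
Proof. by move=> u_rho; rewrite /F/= clampv_id// (le_trans u_rho). Qed.

Lemma continuous_eq0_left (g : R -> R) t : continuous g -> 0 < t ->
  (forall s, 0 <= s < t -> g s = 0) -> g t = 0.
Proof.
move=> cg t0 H.
have H1 : g s @[s --> t^'-] --> g t by apply: cvg_at_left_filter; exact: cg.
have H2 : g s @[s --> t^'-] --> (0 : R).
  apply: (@cvg_trans _ ((cst 0 : R -> R) @ t^'-)); last exact: cvg_cst.
  apply: near_eq_cvg; near=> s; rewrite H//; apply/andP; split.
    by near: s; exact: nbhs_left_ge.
  by near: s; exact: nbhs_left_lt.
exact: (cvg_unique _ H1 H2).
Unshelve. all: by end_near. Qed.

Lemma volterra_caputo_solution X x0 :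
  coordwise_continuous X -> (forall t, X t = volterra_map alpha F x0 X t) ->
  (forall t, 0 <= t -> enorm (X t) <= rho) ->
  caputo_solution alpha D f x0 +oo%E X.
Proof.
move=> cX XE Xrho.
have X0 : X 0 = x0 by rewrite XE volterra_map_le0.
have cF := coordwise_lipschitz_comp L_ge0 f_trunc cX.
split => //.
- by apply: continuous_subspaceT; exact: continuous_coord.
- by move=> t [t0 _]; apply: rho_D; exact: Xrho.
move=> t _ t0.
have E i : (fun s => X s 0 i - X 0 0 i) =
    (fun s => volterra_cst alpha * kernel_integral alpha (fun s => F (X s) 0 i) s).
  by apply/funext => s; rewrite X0 {1}XE mxE (addrC (x0 0 i)) addrK.
have RD i := RL_derive_volterra alpha_gt0 alpha_lt1 (cF i) t0.
split; first by move=> i; rewrite E; exact: (RD i).1.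
apply/rowP => i; rewrite mxE E (RD i).2 /=.
by rewrite -(trunc_id (Xrho _ (ltW t0))).
Qed.

(** A function continuous on [0, T) is frozen after [t1 < T], which gives a
    function continuous on the whole line and unchanged on [0, t1]. *)
Lemma continuous_clamped (x : R -> 'rV[R]_d) (T : \bar R) t1 :
  {within time_dom T, continuous x} -> (t1%:E < T)%E -> 0 <= t1 ->
  coordwise_continuous (x \o clamp 0 t1).
Proof.
move=> cx t1T t10 i s.
have dom r : time_dom T (clamp 0 t1 r).
  have /andP[r0 rt] := clamp_itv r t10.
  by split => //; apply: le_lt_trans t1T; rewrite lee_fin.
apply: (@continuous_comp _ _ _ (x \o clamp 0 t1) (fun u : 'rV[R]_d => u 0 i)).
  have /subspace_continuousP/(_ _ (dom s)) H := cx.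
  apply: cvg_comp H => A [B /= nB BA].
  have nB' : \forall r \near s, ball_ [eta Num.Def.normr] (clamp 0 t1 s) B (clamp 0 t1 r).
    exact: (continuous_clamp (nbhs_ball_norm _ (PosNum nB))).
  by apply: filterS nB' => r /= /BA; apply; exact: dom.
exact: coord_continuous.
Qed.

Lemma caputo_solution_unique X x0 T (x : R -> 'rV[R]_d) t1 :
  coordwise_continuous X -> (forall t, X t = volterra_map alpha F x0 X t) ->
  caputo_solution alpha D f x0 T x -> (t1%:E < T)%E -> 0 < t1 ->
  (forall s, 0 <= s <= t1 -> enorm (x s) <= rho) ->
  forall s, 0 <= s <= t1 -> x s = X s.
Proof.
move=> cX XE [T0 x0E cx xD xder] t1T t10 xrho.
pose y := x \o clamp 0 t1.
have yE s : 0 <= s <= t1 -> y s = x s by move=> st; rewrite /y/= clamp_id.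
have domE s : 0 <= s <= t1 -> time_dom T s.
  by move=> /andP[s0 st]; split => //; apply: le_lt_trans t1T; rewrite lee_fin.
have cy : coordwise_continuous y by exact: continuous_clamped (ltW t10).
have yrho s : enorm (y s) <= rho by apply: xrho; apply: clamp_itv; exact: ltW.
have cF := coordwise_lipschitz_comp L_ge0 f_trunc cy.
have y0 : y 0 = x0 by rewrite yE ?lexx ?(ltW t10).
have yV s : 0 <= s < t1 -> y s = volterra_map alpha F x0 y s.
  move=> st; apply/rowP => i; rewrite mxE.
  have cw : continuous (fun s => y s 0 i - x0 0 i).
    by move=> r; apply: cvgB; [exact: cy|exact: cvg_cst].
  have w0 : y 0 0 i - x0 0 i = 0 by rewrite y0 subrr.
  have fg s' : 0 <= s' < t1 -> x s' 0 i - x 0 0 i = y s' 0 i - x0 0 i.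
    by move=> /andP[s0' st']; rewrite yE ?x0E// s0' ltW.
  have H r : 0 < r < t1 -> RL_derivable alpha (fun s => y s 0 i - x0 0 i) r /\
      RL_derive alpha (fun s => y s 0 i - x0 0 i) r = F (y r) 0 i.
    move=> /[dup] rt /andP[r0 rt1].
    have rt' : 0 <= r <= t1 by rewrite !ltW.
    have [dx ex] := xder _ (domE _ rt') r0.
    have [dE eE] := eq_RL_derive alpha rt fg.
    split; first by apply: dE; exact: dx.
    rewrite -eE trunc_id// yE// -ex mxE//.
  rewrite -(volterra_of_RL_derive alpha_gt0 alpha_lt1 (cF i) cw w0 H st).
  by rewrite addrC subrK.
have XV s : 0 <= s < t1 -> X s = volterra_map alpha F x0 X s by move=> _; exact: XE.
have yX s : 0 <= s < t1 -> y s = X s.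
  exact: (volterra_solution_unique alpha_gt0 alpha_lt1 L_ge0 f_trunc cy cX yV XV).
move=> s /[dup] st /andP[s0]; rewrite -yE// le_eqVlt => /predU1P[->|st1]; last first.
  by apply: yX; rewrite s0.
apply/rowP => i; apply/eqP; rewrite -subr_eq0; apply/eqP.
apply: (@continuous_eq0_left (fun s => y s 0 i - X s 0 i)) => //.
  by move=> r; apply: cvgB; [exact: cy|exact: cX].
by move=> r rt; rewrite yX// subrr.
Qed.

(** A solution leaving the ball of radius [e] would agree with [X] up to its first
    exit, where [X] has norm less than [e].  So it agrees with [X] throughout, and
    if its interval were bounded, [X] would extend it. *)
Lemma maximal_solutions_eq X x0 e : e <= rho ->
  coordwise_continuous X -> (forall t, X t = volterra_map alpha F x0 X t) ->
  (forall t, 0 <= t -> enorm (X t) < e) ->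
  maximal_solution_satisfies alpha D f x0 (fun T (x : R -> 'rV[R]_d) =>
    T = +oo%E /\ forall t, 0 <= t -> x t = X t).
Proof.
move=> e_rho cX XE Xe.
have Xrho t : 0 <= t -> enorm (X t) <= rho by move=> t0; rewrite (le_trans (ltW (Xe _ t0))).
have solX := volterra_caputo_solution cX XE Xrho.
have X0 : X 0 = x0 by rewrite XE volterra_map_le0.
split; first by exists +oo%E, X; split => // T' y; rewrite ltNge leey.
move=> T x [solx maxx].
have [T0 x0E cx xD xder] := solx.
have xe t2 : time_dom T t2 -> enorm (x t2) < e.
  move=> [t20 t2T]; rewrite ltNge; apply/negP => et2.
  have cy := continuous_clamped cx t2T t20.
  have yE s : 0 <= s <= t2 -> (x \o clamp 0 t2) s = x s by move=> st; rewrite /= clamp_id.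
  have [t1 [t10 t1t2 et1 t1e]] : exists t1, [/\ 0 < t1, t1 <= t2,
      enorm ((x \o clamp 0 t2) t1) = e &
      forall s, 0 <= s <= t1 -> enorm ((x \o clamp 0 t2) s) <= e].
    apply: (first_exit (continuous_enorm cy)) => //.
      by rewrite yE ?lexx// x0E -X0 Xe.
    by rewrite yE ?lexx ?t20.
  have xrho s : 0 <= s <= t1 -> enorm (x s) <= rho.
    move=> /[dup] st /andP[s0 st1]; rewrite -yE ?s0 ?(le_trans st1)//.
    by apply: le_trans e_rho; exact: t1e.
  have t1T : (t1%:E < T)%E by apply: le_lt_trans t2T; rewrite lee_fin.
  have t1t1 : 0 <= t1 <= t1 by rewrite lexx ltW.
  have := caputo_solution_unique cX XE solx t1T t10 xrho t1t1.
  rewrite -yE ?(ltW t10)// => yX; move: et1; rewrite yX => et1.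
  by have := Xe _ (ltW t10); rewrite et1 ltxx.
have xX t : time_dom T t -> x t = X t.
  move=> /[dup] [[t0 tT]] tdom; move: t0; rewrite le_eqVlt => /predU1P[t0|t0].
    by rewrite -t0 x0E X0.
  apply: (caputo_solution_unique cX XE solx tT t0); last by rewrite lexx ltW.
  move=> s /andP[s0 st]; apply: le_trans e_rho; apply/ltW/xe; split => //.
  by apply: le_lt_trans tT; rewrite lee_fin.
have Too : T = +oo%E.
  apply/eqP; apply: contrapT => /negP T1.
  have Tlt : (T < +oo)%E by rewrite ltey.
  by apply: (maxx _ X Tlt) => // t /xX ->.
split => // t t0; apply: xX; split => //.
by rewrite Too ltry.
Qed.

End maximal_solutions.

Lemma maximal_solution_satisfiesW (R : realType) (d : nat) (alpha : R)
    (D : set 'rV[R]_d) (f : 'rV[R]_d -> 'rV[R]_d) (x0 : 'rV[R]_d)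
    (P Q : \bar R -> (R -> 'rV[R]_d) -> Prop) :
  (forall T x, P T x -> Q T x) ->
  maximal_solution_satisfies alpha D f x0 P ->
  maximal_solution_satisfies alpha D f x0 Q.
Proof. by move=> PQ [ex all]; split => // T x /all /PQ. Qed.

(** The bound [C1 * e ^ a] is a lower bound of the Lyapunov function on the sphere
    of radius [e]. *)
Lemma initial_radius (R : realType) (a b C1 C2 e : R) :
  0 < b -> 0 < C1 -> 0 < C2 -> 0 < e ->
  exists delta, [/\ 0 < delta, delta < e &
    forall z, 0 <= z -> z <= delta -> C2 * z `^ b < C1 * e `^ a].
Proof.
move=> b0 C10 C20 e0.
have ea : 0 < e `^ a by rewrite powR_gt0.
pose q := C1 * e `^ a / (2 * C2).
have q0 : 0 < q by rewrite /q divr_gt0// mulr_gt0.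
exists (Num.min (e / 2) (q `^ b^-1)); split.
- by rewrite lt_min divr_gt0// powR_gt0.
- by rewrite gt_min; apply/orP; left; rewrite ltr_pdivrMr// ltr_pMr// ltr1n.
move=> z z0; rewrite le_min => /andP[_ zq].
apply: (@le_lt_trans _ _ (C2 * q)).
  rewrite ler_pM2l// (_ : q = (q `^ b^-1) `^ b); last first.
    by rewrite -powRrM mulVf ?gt_eqF// powRr1// ltW.
  by apply: ge0_ler_powR => //; rewrite ?nnegrE ?powR_ge0// ltW.
rewrite /q (_ : C2 * _ = C1 * e `^ a / 2); last by field; rewrite gt_eqF.
by rewrite ltr_pdivrMr// ltr_pMr ?mulr_gt0// ltr1n.
Qed.

Theorem theorem25 (R : realType) (d : nat) (alpha : R)
    (halpha : 0 < alpha < 1)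
    (D : set 'rV[R]_d) (D_open : open D) (D0 : D 0)
    (f : 'rV[R]_d -> 'rV[R]_d) (f0 : f 0 = 0) (f_lip : lipschitz_near0 D f)
    (V : 'rV[R]_d -> R) (V_ge0 : forall x, 0 <= V x)
    (V_convex : convex_function setT V)
    (V_diff : forall x, differentiable V x)
    (a b C1 C2 r : R) (ha : 0 < a) (hb : 0 < b) (hC1 : 0 < C1) (hC2 : 0 < C2)
    (hr : 0 < r) (ball_sub : eball r `<=` D)
    (V_bounds : forall x, eball r x ->
      C1 * enorm x `^ a <= V x <= C2 * enorm x `^ b)
    (C3 c : R) (hC3 : 0 <= C3) (hc : 0 <= c)
    (V_decay : forall x, eball r x ->
      dotv (gradient V x) (f x) <= - C3 * enorm x `^ c) :
  (C3 = 0 -> stable alpha D f) /\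
  (0 < C3 -> mittag_leffler_stable alpha D f).
Proof.
have /andP[alpha0 alpha1] := halpha.
have [h [L [h0 L0 fL]]] := lipschitz_truncation f_lip.
pose rho := Num.min h r.
have rho0 : 0 < rho by rewrite lt_min h0.
have rho_h : rho <= h by rewrite ge_min lexx.
have rho_r : rho <= r by rewrite ge_min lexx orbT.
have rho_D : eball rho `<=` D.
  by move=> x xrho; apply: ball_sub; exact: le_trans rho_r.
have truncE u : enorm u <= rho -> f (clampv h u) = f u.
  by move=> u_rho; rewrite clampv_id// (le_trans u_rho).
have solution e x0 : e <= rho -> enorm x0 < e -> C2 * enorm x0 `^ b < C1 * e `^ a ->
    exists X, [/\ X 0 = x0, solves_volterra alpha X (fun t => f (clampv h (X t))),
      forall t, 0 <= t -> enorm (X t) < e &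
      maximal_solution_satisfies alpha D f x0 (fun T x =>
        T = +oo%E /\ forall t, 0 <= t -> x t = X t)].
  move=> e_rho x0e x0V.
  have [X [cX XE]] := volterra_solution_exists x0 alpha0 alpha1 L0 fL.
  have X0 : X 0 = x0 by rewrite XE volterra_map_le0.
  have sX : solves_volterra alpha X (fun t => f (clampv h (X t))).
    split => //; first exact: coordwise_lipschitz_comp L0 fL cX.
    by move=> t i _; rewrite {1}XE mxE X0.
  have Xe : forall t, 0 <= t -> enorm (X t) < e.
    apply: (V_stays_in_ball alpha0 alpha1 V_convex V_diff sX (a := a) (b := b)
      (C1 := C1) (C2 := C2)); rewrite ?X0//.
    - by move=> x xe; apply: V_bounds; rewrite /eball/= (le_trans xe)// (le_trans e_rho).
    move=> s _ Xs; rewrite truncE ?(le_trans Xs)//.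
    apply: le_trans (V_decay _ _) _.
      by rewrite /eball/= (le_trans Xs)// (le_trans e_rho).
    by rewrite mulNr oppr_le0 mulr_ge0 ?powR_ge0.
  exists X; split => //.
  exact: (maximal_solutions_eq alpha0 alpha1 L0 fL rho_h rho_D e_rho cX XE Xe).
split=> [_ eps eps0|C30].
  pose e := Num.min eps rho.
  have e0 : 0 < e by rewrite lt_min eps0.
  have e_rho : e <= rho by rewrite ge_min lexx orbT.
  have [delta [delta0 delta_e Hdelta]] := initial_radius a hb hC1 hC2 e0.
  exists delta => // x0 x0d.
  have [X [_ _ Xe maxX]] := solution e x0 e_rho (lt_trans x0d delta_e)
    (Hdelta _ (enorm_ge0 _) (ltW x0d)).
  apply: maximal_solution_satisfiesW maxX => T x [-> xX]; split => // t t0.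
  by rewrite xX// (lt_le_trans (Xe _ t0))// /e ge_min lexx.
have c0 : 0 < c.
  rewrite lt_neqAle hc andbT; apply/eqP => c0.
  have := V_decay 0; rewrite /eball/= enorm0 (ltW hr) f0 -c0 powRr0 mulr1.
  rewrite /dotv big1 => [/(_ isT)|i _]; last by rewrite [X in _ * X]mxE mulr0.
  by rewrite oppr_ge0 leNgt C30.
have [delta [delta0 delta_rho Hdelta]] := initial_radius a hb hC1 hC2 rho0.
pose W := C2 * delta `^ b.
have W0 : 0 < W by rewrite mulr_gt0// powR_gt0.
pose beta := Num.min (alpha * (b / c)) alpha.
have beta0 : 0 < beta by rewrite lt_min alpha0 andbT mulr_gt0// divr_gt0.
pose N := W + C2 * (W * (2 `^ alpha + (1 - 2 `^ (- alpha))^-1) * alpha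
              / volterra_cst alpha / C3) `^ (b / c).
have N0 : 0 < N by rewrite /N ltr_wpDr// mulr_ge0 ?powR_ge0// ltW.
exists (beta / a), ((N / C1) `^ a^-1), delta; split => //.
- by rewrite divr_gt0.
- by rewrite powR_gt0// divr_gt0.
move=> x0 x0d.
have [X [X0 sX Xe maxX]] := solution rho x0 (lexx _) (le_lt_trans x0d delta_rho)
  (Hdelta _ (enorm_ge0 _) x0d).
have Xr t : 0 <= t -> eball r (X t).
  by move=> t0; rewrite /eball/= (le_trans (ltW (Xe _ t0))).
apply: maximal_solution_satisfiesW maxX => T x [-> xX]; split => //.
move=> S; apply: ge_ereal_sup => y [t /=]; rewrite in_itv/= andbT => t0 <-{y}.
rewrite lee_fin xX//.
have VX0 : V (X 0) <= W.
  have /andP[_ h1] := V_bounds _ (Xr 0 (lexx _)).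
  apply: le_trans h1 _; rewrite X0 ler_pM2l// ge0_ler_powR ?nnegrE ?enorm_ge0//.
  - exact: ltW.
  - exact: ltW.
have decay := V_algebraic_decay alpha0 alpha1 V_convex V_diff V_ge0 sX hb c0 hC2 C30 W0
  (e := rho) _ _ _ VX0 t0.
have {decay} : t `^ beta * V (X t) <= N.
  apply: decay.
  - by move=> u u_rho; apply: V_bounds; rewrite /eball/= (le_trans u_rho).
  - by move=> s s0; rewrite ltW// Xe.
  - move=> s s0; rewrite truncE ?(ltW (Xe _ s0))//.
    by apply: V_decay; exact: Xr.
have /andP[h1 _] := V_bounds _ (Xr _ t0).
move=> h2.
have h3 : t `^ beta * enorm (X t) `^ a <= N / C1.
  rewrite ler_pdivlMr// -mulrA (mulrC _ C1); apply: le_trans h2.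
  by rewrite ler_wpM2l ?powR_ge0.
have -> : t `^ (beta / a) * enorm (X t) = (t `^ beta * enorm (X t) `^ a) `^ a^-1.
  rewrite powRM ?powR_ge0// -!powRrM; congr (_ * _).
  by rewrite divff ?powRr1 ?enorm_ge0// gt_eqF.
apply: ge0_ler_powR => //; rewrite ?nnegrE.
- by rewrite invr_ge0 ltW.
- by rewrite mulr_ge0 ?powR_ge0.
- by rewrite divr_ge0// ltW.
Qed.
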